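(* Let $p\in(0,1)$, $q=1-p$, and let $D$ be the diffusion coefficient of the one-dimensional Bertini–Toninelli model, i.e. the exclusion process on $\{0,1\}^{\mathbb{Z}}$ with nearest-neighbour exchange rates $c(x,x+1;\eta)=1-\eta(x-1)\eta(x+2)$. Then the following lower bounds all hold: $$D\ge\frac{2q}{1+q},\qquad D\ge\frac{9q^2}{7-4q+6q^2},\qquad D\ge\frac{1}{5000}\,p\,q^9.$$ In particular $D\ne0$.
   Context: Let $\Omega=\{0,1\}^{\mathbb{Z}}$ and let $\mu$ be the product of Bernoulli($p$) measures on $\Omega$; $\mu[f]$ denotes expectation. For $\eta\in\Omega$, $\eta^{x,y}$ is $\eta$ with the values at $x$ and $y$ exchanged. Translations: $(\tau_x\eta)(y)=\eta(y-x)$, $\tau_xf(\eta)=f(\tau_x\eta)$. The rates are $c(x,x+1;\eta)=c(x+1,x;\eta)=1-\eta(x-1)\eta(x+2)$ and $c(x,y;\eta)=0$ if $|x-y|\ne1$. The generator acts on local functions (those depending on finitely many coordinates) by $\mathcal{L}f(\eta)=\frac12\sum_{x,y\in\mathbb{Z}}c(x,y;\eta)(f(\eta^{x,y})-f(\eta))$; the process is reversible with respect to $\mu$, and $e^{t\mathcal{L}}$ is its Markov semigroup. The current is $j(\eta)=\frac12\sum_{z=\pm1}z\,c(0,z;\eta)(\eta(0)-\eta(z))$. The diffusion coefficient (a nonnegative real number depending on $p$) is given by the Green–Kubo formula $$D=\frac1{pq}\left(\frac14\sum_{z=\pm1}z^2\,\mu\left[c(0,z;\eta)(\eta(0)-\eta(z))^2\right]-\int_0^\infty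 dt\sum_{x\in\mathbb{Z}}\mu\left[\tau_xj\;e^{t\mathcal{L}}j\right]\right).$$ *)

(* Defs.v *)
From HB Require Import structures.
From mathcomp Require Import all_boot all_order all_algebra.
From mathcomp Require Import all_classical all_reals all_analysis.

Set Implicit Arguments.
Unset Strict Implicit.
Unset Printing Implicit Defensive.

Import Order.TTheory GRing.Theory Num.Theory.
Import numFieldNormedType.Exports.

Local Open Scope classical_set_scope.
Local Open Scope ring_scope.

(* {ptws _ -> _} carries the product topology, bool being discrete. *)
Definition Omega := {ptws int -> bool}.

Definition exchange (x y : int) (eta : Omega) : Omega :=
  fun z => if z == x then eta y else if z == y then eta x else eta z.

Definition shift_conf (x : int) (eta : Omega) : Omega := fun y => eta (y - x).

Definition one_site_events : set (set (int -> bool)) :=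
  [set [set eta : int -> bool | eta x] | x in [set: int]].

Notation OmegaM := (g_sigma_algebraType one_site_events).

Section Model.
Variable R : realType.
Implicit Types (f : Omega -> R) (eta : Omega).

Definition shift_fun (x : int) f : Omega -> R := fun eta => f (shift_conf x eta).

Definition occ eta (x : int) : R := (eta x)%:R.

Definition is_local f : Prop :=
  exists A : seq int, forall eta xi : Omega,
    (forall x, x \in A -> eta x = xi x) -> f eta = f xi.

Definition bernoulli_product (p : R) (mu : probability OmegaM R) : Prop :=
  forall (A : seq int) (sigma : int -> bool), uniq A ->
    mu [set eta : int -> bool | forall x, x \in A -> eta x = sigma x] =
    (\prod_(x <- A) bernoulli_pmf p (sigma x))%:E.

Definition rate (x y : int) eta : R :=
  if y == x + 1 then 1 - occ eta (x - 1) * occ eta (x + 2)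
  else if x == y + 1 then 1 - occ eta (y - 1) * occ eta (y + 2)
  else 0.

(* For a local f only finitely many terms are nonzero, so that the finitely
   supported sum is the full sum over Z * Z; for other f the value is
   meaningless. *)
Definition generator f : Omega -> R := fun eta =>
  2^-1 * \sum_(xy \in [set: int * int])
    (rate xy.1 xy.2 eta * (f (exchange xy.1 xy.2 eta) - f eta)).

(* Markov semigroups on C(Omega), as in Liggett, Interacting Particle Systems,
   Definition I.1.4; the values of S outside t >= 0 and continuous f are
   unconstrained. *)
Record markov_semigroup (S : R -> (Omega -> R) -> Omega -> R) : Prop := {
  semigroup_continuous : forall (t : R) f, 0 <= t -> continuous f ->
    continuous (S t f);
  semigroup_linear : forall (t a : R) (f g : Omega -> R), 0 <= t ->
    continuous f -> continuous g ->
    S t (fun eta => a * f eta + g eta) = (fun eta => a * S t f eta + S t g eta);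
  semigroup0 : forall f, continuous f -> S 0 f = f;
  semigroupD : forall (s t : R) f, 0 <= s -> 0 <= t -> continuous f ->
    S (s + t) f = S s (S t f);
  semigroup1 : forall t : R, 0 <= t -> S t (fun=> 1) = (fun=> 1);
  semigroup_ge0 : forall (t : R) f, 0 <= t -> continuous f ->
    (forall eta, 0 <= f eta) -> forall eta, 0 <= S t f eta;
  semigroup_right_continuous : forall (t : R) f, 0 <= t -> continuous f ->
    {uniform, (fun s => S s f) @ t^'+ --> S t f}
}.

(* The rates being bounded and of finite range, the local functions form a core
   (Liggett, Theorem I.3.9): exactly one Markov semigroup satisfies this. *)
Definition generated_by (S : R -> (Omega -> R) -> Omega -> R)
    (L : (Omega -> R) -> Omega -> R) : Prop :=
  forall f, is_local f ->
    {uniform, (fun t eta => t^-1 * (S t f eta - f eta)) @ 0^'+ --> L f}.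

Definition current eta : R :=
  2^-1 * \sum_(z <- [:: 1; -1] : seq int)
    (z%:~R * rate 0 z eta * (occ eta 0 - occ eta z)).

(* Sum over all integers of an absolutely summable family of reals, as the
   difference of the sums of the positive and negative parts. *)
Definition sumZ (u : int -> R) : \bar R :=
  (\esum_(x in [set: int]) (Num.max (u x) 0)%:E -
   \esum_(x in [set: int]) (Num.max (- u x) 0)%:E)%E.

Section GreenKubo.
Variables (p : R) (mu : probability OmegaM R).
Variable S : R -> (Omega -> R) -> Omega -> R.

Definition current_correlation (t : R) : \bar R :=
  sumZ (fun x => \int[mu]_eta (shift_fun x current eta * S t current eta)).

Definition instantaneous_term : R :=
  4^-1 * \sum_(z <- [:: 1; -1] : seq int)
    (z%:~R ^+ 2 *
     \int[mu]_eta (rate 0 z eta * (occ eta 0 - occ eta z) ^+ 2)).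

Definition green_kubo : \bar R :=
  ((p * (1 - p))^-1%:E *
   (instantaneous_term%:E -
    \int[lebesgue_measure]_(t in `[0%R, +oo[) current_correlation t))%E.

Definition diffusion_coefficient : R := fine green_kubo.

End GreenKubo.
End Model.

(* Main.v *)
(** Take lambda = 1/(1+q) and split the current as j = psi + lambda phi, up to
   bounded boundary terms of its sums over blocks, where phi is the current of
   the porous medium model with rates (1 - eta(x-1)) + (1 - eta(x+2)): phi is a
   discrete gradient and vanishes wherever the Bertini-Toninelli rates do.  Let
   J_n be the sum of n consecutive translates of j and u the integral over
   [0, T] of e^(tL) J_n, so that L u = e^(TL) J_n - J_n.  Exchange antisymmetry
   of psi and the AM-GM inequality bound mu[J_n u] by the energy of psi, half the
   Dirichlet form of u and the pairing of u with the boundary terms.  The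
   Dirichlet form is at most mu[J_n u], whence
     mu[J_n u] <= n mu[c (1 - lambda c')^2 (eta(0)-eta(1))^2]/2 + o(n),
   with c the rate of the bond {0, 1} and c' that of the porous medium model.
   Dividing by n, letting n and then T tend to infinity bounds the time integral
   of the current correlation by the difference between the instantaneous term
   and pq 2q/(1+q).  The other two lower bounds are smaller than 2q/(1+q).

   The analytic input is that for f local on [-m, m] the Taylor series of
   e^(sL) f converges for s <= 1/32 with error 2^(m-K) sup |f|, its K-th partial sum
   being local on [-m-2K, m+2K].  Iterating in time, e^(tL) f stays in the domain
   of the closure of L on local functions, and is exponentially well approximated
   by local functions, so the spatial correlations are summable. *)

Require Import Defs.
From mathcomp Require Import all_boot all_order all_algebra.
From mathcomp Require Import all_classical all_reals all_analysis.
From mathcomp Require Import zify ring lra.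
From mathcomp Require Import measurable_realfun.

Set Implicit Arguments.
Unset Strict Implicit.
Unset Printing Implicit Defensive.

Import Order.TTheory GRing.Theory Num.Theory.
Import numFieldNormedType.Exports.

Local Open Scope classical_set_scope.
Local Open Scope ring_scope.

(** * Local functions and the generator *)

Definition swap (x : int) : Omega -> Omega := exchange x (x + 1).

Section Local.
Variable R : realType.
Implicit Types (f g : Omega -> R) (eta xi : Omega).

Definition bond_rate (x : int) eta : R :=
  1 - occ R eta (x - 1) * occ R eta (x + 2).

Definition grad (x : int) f : Omega -> R := fun eta => f (swap x eta) - f eta.

(** A quantitative form of [is_local]: the radius is kept so that the growth of supports under
    powers of the generator can be measured. *)
Definition local_on (m : nat) f : Prop := forall eta xi : Omega,
  (forall x : int, (`|x| <= m)%N -> eta x = xi x) -> f eta = f xi.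

Definition bounded_by (M : R) f : Prop := forall eta, `|f eta| <= M.

Lemma is_localP f : is_local f <-> exists m, local_on m f.
Proof.
split=> [[A fA]|[m fm]].
  exists (\max_(x <- A) `|x|)%N => eta xi h; apply: fA => x xA; apply: h.
  exact: (@leq_bigmax_seq _ _ xpredT absz _ xA isT).
exists [seq (i%:Z - m%:Z) | i <- iota 0 (2 * m).+1] => eta xi h.
apply: fm => x xm; apply: h; apply/mapP; exists (absz (x + m%:Z)); last by lia.
by rewrite mem_iota; lia.
Qed.

Lemma local_on_leq m n f : (m <= n)%N -> local_on m f -> local_on n f.
Proof. by move=> mn fm eta xi h; apply: fm => x xm; apply: h; lia. Qed.

Lemma local_on_cst m c : local_on m (fun=> c).
Proof. by []. Qed.

Lemma local_onD m f g : local_on m f -> local_on m g ->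
  local_on m (fun eta => f eta + g eta).
Proof. by move=> fm gm eta xi h; rewrite (fm _ _ h) (gm _ _ h). Qed.

Lemma local_onM m f g : local_on m f -> local_on m g ->
  local_on m (fun eta => f eta * g eta).
Proof. by move=> fm gm eta xi h; rewrite (fm _ _ h) (gm _ _ h). Qed.

Lemma local_on_sum m (I : Type) (r : seq I) (P : pred I) (F : I -> Omega -> R) :
  (forall i, P i -> local_on m (F i)) ->
  local_on m (fun eta => \sum_(i <- r | P i) F i eta).
Proof. by move=> Fm eta xi h; apply: eq_bigr => i Pi; apply: Fm. Qed.

(** In the product of discrete topologies the finitely many coordinates in [[-m, m]] are locally
    constant, hence so is [f]. *)
Lemma local_on_continuous m f : local_on m f -> continuous f.
Proof.
move=> fm eta; apply: cvg_near_cst.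
suff : \forall xi \near eta, forall i : 'I_(2 * m).+1,
    xi (i%:Z - m%:Z) = eta (i%:Z - m%:Z).
  apply: filterS => xi h; apply: fm => x xm.
  have im : (absz (x + m%:Z)%R < (2 * m).+1)%N by lia.
  have := h (Ordinal im); rewrite /=.
  by rewrite (_ : (absz (x + m%:Z))%:Z - m%:Z = x)//; lia.
apply: (@filter_forall _ 'I_(2 * m).+1
  (fun i xi => xi (i%:Z - m%:Z) = eta (i%:Z - m%:Z)) (nbhs eta)) => i.
apply: (@proj_continuous int (fun=> bool) (i%:Z - m%:Z) eta
  [set b | b = eta (i%:Z - m%:Z)]).
by rewrite nbhs_principalE; apply/principal_filterP.
Qed.
End Local.

(* For i < 2 M + 2 these are the left ends of all bonds meeting [-M, M]. *)
Definition bond (M i : nat) : int := i%:Z - M.+1%:Z.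

Section Generator.
Variable R : realType.
Implicit Types (f g : Omega -> R) (eta xi : Omega).

Lemma exchangeC x y eta : exchange x y eta = exchange y x eta.
Proof.
apply/funext => z; rewrite /exchange.
have [->|zx] := eqVneq z x; have [E|E] := eqVneq _ y => //.
by rewrite E.
Qed.

Lemma swapE x eta z : swap x eta z =
  if z == x then eta (x + 1) else if z == x + 1 then eta x else eta z.
Proof. by []. Qed.

Lemma swapK x : involutive (swap x).
Proof.
have nx : (x + 1 == x) = false by apply/eqP; lia.
move=> eta; apply/funext => z; rewrite !swapE !eqxx nx.
have [->//|_] := eqVneq z x.
by have [->|] := eqVneq z (x + 1).
Qed.

Lemma rateS x eta : rate R x (x + 1) eta = bond_rate R x eta.
Proof. by rewrite /rate eqxx. Qed.

Lemma rateSC x eta : rate R (x + 1) x eta = bond_rate R x eta.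
Proof. by rewrite /rate eqxx ifF//; apply/eqP; lia. Qed.

Lemma bond_rate_ge0 x eta : 0 <= bond_rate R x eta.
Proof. by rewrite /bond_rate /occ; case: (eta _); case: (eta _) => /=; lra. Qed.

Lemma bond_rate_le1 x eta : bond_rate R x eta <= 1.
Proof. by rewrite /bond_rate /occ; case: (eta _); case: (eta _) => /=; lra. Qed.

Lemma bond_rate_swap x eta : bond_rate R x (swap x eta) = bond_rate R x eta.
Proof. by rewrite /bond_rate /occ !swapE !ifF//; apply/eqP; lia. Qed.

Lemma grad_eq0 m f x eta : local_on m f ->
  (m < absz x)%N -> (m < absz (x + 1)%R)%N -> grad x f eta = 0.
Proof.
move=> fm h1 h2; rewrite /grad (fm _ eta) ?subrr// => z zm.
by rewrite swapE !ifF//; apply/eqP => zE; move: zm h1 h2; rewrite zE; lia.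
Qed.

(** Each bond occurs in the double sum as [(x, x + 1)] and as [(x + 1, x)], which cancels the factor
    1/2, and bonds that miss the support have zero gradient. The radius [M] is left free so that
    several functions can share one index set. *)
Lemma generatorE m M f eta : local_on m f -> (m <= M)%N ->
  generator f eta =
  \sum_(i < (2 * M).+2) bond_rate R (bond M i) eta * grad (bond M i) f eta.
Proof.
move=> fm mM; rewrite /generator.
set F := fun xy : int * int => _.
pose s := [seq bond M i | i <- iota 0 (2 * M).+2].
pose s1 := [seq (x, x + 1) | x <- s].
pose s2 := [seq (x + 1, x) | x <- s].
have sP x : x \notin s -> (M < absz x)%N /\ (M < absz (x + 1)%R)%N.
  move=> xs.
  have : ~ ((- M.+1%:Z <= x) && (x <= M%:Z)); last by lia.
  move=> h; move/negP: xs; apply; apply/mapP.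
  exists (absz (x + M.+1%:Z)); last by rewrite /bond; lia.
  by rewrite mem_iota; lia.
have bond_inj : injective (bond M) by move=> i k; rewrite /bond => ?; lia.
have us : uniq s by rewrite map_inj_uniq ?iota_uniq.
have us12 : uniq (s1 ++ s2).
  have i1 : injective (fun x : int => (x, x + 1)) by move=> x y [->].
  have i2 : injective (fun x : int => (x + 1, x)) by move=> x y [_ ->].
  rewrite cat_uniq (map_inj_uniq i1) (map_inj_uniq i2) us.
  rewrite andTb andbT; apply/hasPn => -[x y] /mapP[z zs [-> ->]].
  by apply/negP => /mapP[t ts []]; lia.
have F0 xy : xy \notin s1 ++ s2 -> F xy = 0.
  case: xy => x y; rewrite mem_cat negb_or => /andP[n1 n2].
  rewrite /F /= /rate; case: eqVneq => [yx|_].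
    subst y; have xs : x \notin s.
      by apply/negP => xs; move/negP: n1; apply; apply/mapP; exists x.
    have [h1 h2] := sP _ xs.
    by rewrite [X in _ * X](_ : _ = 0) ?mulr0//; apply: (grad_eq0 _ fm); lia.
  case: eqVneq => [xy|_]; last by rewrite mul0r.
  subst x; have ys : y \notin s.
    by apply/negP => xs; move/negP: n2; apply; apply/mapP; exists y.
  have [h1 h2] := sP _ ys; rewrite exchangeC.
  by rewrite [X in _ * X](_ : _ = 0) ?mulr0//; apply: (grad_eq0 _ fm); lia.
rewrite -(@fsbig_widen _ _ _ _ [set` s1 ++ s2])//; last first.
  by move=> xy [_ /= /negP]; exact: F0.
rewrite -fsbig_seq// big_cat/= !big_map.
under eq_bigr do rewrite /F/= rateS.
under [X in _ + X]eq_bigr do rewrite /F/= rateSC exchangeC.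
rewrite -[iota _ _]/(index_iota 0 (2 * M).+2) big_mkord.
by rewrite -mulr2n -[X in _ * X]mulr_natl mulrA mulVf ?mul1r ?pnatr_eq0.
Qed.

Lemma local_on_grad m x f : local_on m f -> (absz x <= m)%N ->
  (absz (x + 1)%R <= m)%N -> local_on m (grad x f).
Proof.
move=> fm xm x1m eta xi h; rewrite /grad (fm _ _ h); congr (_ - _); apply: fm => z zm.
by rewrite !swapE !h.
Qed.

Lemma local_on_bond_rate m (x : int) : (absz (x - 1)%R <= m)%N -> (absz (x + 2)%R <= m)%N ->
  local_on m (bond_rate R x).
Proof.
by move=> h1 h2 eta xi h; rewrite /bond_rate /occ !h.
Qed.

Lemma local_on_generator m f : local_on m f -> local_on m.+2 (generator f).
Proof.
move=> fm; rewrite (_ : generator f = fun eta => \sum_(i < (2 * m).+2)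
    bond_rate R (bond m i) eta * grad (bond m i) f eta); last first.
  by apply/funext => eta; exact: generatorE fm _.
apply: local_on_sum => i _; have := ltn_ord i => im.
apply: local_onM; first by apply: local_on_bond_rate; rewrite /bond; lia.
apply: local_on_grad; [|by rewrite /bond; lia..].
by apply: local_on_leq fm; lia.
Qed.

(** There are [2 m + 2] bonds, and each contributes at most [2 C] since the rates are at most 1. *)
Lemma bounded_by_generator m C f : local_on m f -> bounded_by C f ->
  bounded_by (4 * m.+1%:R * C) (generator f).
Proof.
move=> fm fC eta; rewrite (generatorE _ fm (leqnn m)).
apply: le_trans (ler_norm_sum _ _ _) _.
apply: (@le_trans _ _ (\sum_(i < (2 * m).+2) (2 * C))).
  apply: ler_sum => i _; rewrite normrM ger0_norm ?bond_rate_ge0//.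
  have := fC (swap (bond m i) eta); have := fC eta.
  have := bond_rate_le1 (bond m i) eta; have := bond_rate_ge0 (bond m i) eta.
  rewrite /grad; set r := bond_rate _ _ _ => r0 r1 f1 f2.
  apply: le_trans (_ : 1 * (2 * C) <= _); last by rewrite mul1r.
  apply: ler_pM => //; apply: le_trans (ler_normB _ _) _.
  by rewrite mulrDl mul1r lerD.
rewrite sumr_const card_ord -[(2 * C) *+ _]mulr_natl.
rewrite (_ : (2 * m).+2 = (2 * m.+1)%N); last by lia.
by rewrite natrM le_eqVlt; apply/orP; left; apply/eqP; ring.
Qed.

Lemma generator_linear m (a : R) f g eta : local_on m f -> local_on m g ->
  generator (fun eta => a * f eta + g eta) eta = a * generator f eta + generator g eta.
Proof.
move=> fm gm; rewrite (@generatorE m m)//; last first.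
  by apply: local_onD => //; apply: local_onM => //; exact: local_on_cst.
rewrite (generatorE _ fm (leqnn m)) (generatorE _ gm (leqnn m)).
rewrite mulr_sumr -big_split/=; apply: eq_bigr => i _; rewrite /grad; ring.
Qed.

End Generator.

(** * Expectation and invariance of the product measure *)

Section Expectation.
Variables (R : realType) (mu : probability OmegaM R).
Implicit Types (f g : Omega -> R) (eta xi : Omega).

(** Bounded measurable functions form an algebra on which every integrability condition is
    automatic. *)
Definition tame f : Prop :=
  measurable_fun setT (f : OmegaM -> R) /\ exists M, bounded_by M f.

Definition expect f : R := \int[mu]_eta f eta.

Lemma tame_integrable f : tame f -> mu.-integrable setT (EFin \o f).
Proof.
move=> [mf [M fM]]; apply: measurable_bounded_integrable => //.
  by rewrite (le_lt_trans (probability_le1 mu measurableT))// ltry.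
exists M; split; first exact: num_real.
by move=> x Mx eta _ /=; rewrite (le_trans (fM eta))// ltW.
Qed.

Lemma tame_cst c : tame (fun=> c).
Proof. by split; [exact: measurable_cst|exists `|c| => eta]. Qed.

Lemma tameD f g : tame f -> tame g -> tame (fun eta => f eta + g eta).
Proof.
move=> [mf [M fM]] [mg [N gN]]; split; first exact: measurable_funD.
by exists (M + N) => eta; apply: le_trans (ler_normD _ _) _; rewrite lerD.
Qed.

Lemma tameM f g : tame f -> tame g -> tame (fun eta => f eta * g eta).
Proof.
move=> [mf [M fM]] [mg [N gN]]; split; first exact: measurable_funM.
by exists (M * N) => eta; rewrite normrM ler_pM.
Qed.

Lemma tameZ a f : tame f -> tame (fun eta => a * f eta).
Proof. by apply: tameM; exact: tame_cst. Qed.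

Lemma tameN f : tame f -> tame (fun eta => - f eta).
Proof.
by move=> /(tameZ (-1)); congr tame; apply/funext => eta; rewrite mulN1r.
Qed.

Lemma tameB f g : tame f -> tame g -> tame (fun eta => f eta - g eta).
Proof. by move=> tf /tameN; exact: tameD. Qed.

Lemma tame_sum (I : Type) (r : seq I) (F : I -> Omega -> R) :
  (forall i, tame (F i)) -> tame (fun eta => \sum_(i <- r) F i eta).
Proof.
move=> tF; elim: r => [|i r ih].
  by under eq_fun do rewrite big_nil; exact: tame_cst.
by under eq_fun do rewrite big_cons; exact: tameD.
Qed.

Lemma measurable_occ x : measurable [set eta : OmegaM | eta x].
Proof. by apply: sub_sigma_algebra; exists x. Qed.

Lemma tame_occ x : tame (fun eta => occ R eta x).
Proof.
split; last by exists 1 => eta; rewrite /occ; case: (eta x); rewrite /= ?normr1 ?normr0.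
rewrite (_ : (fun eta => _) = (\1_[set eta : OmegaM | eta x] : OmegaM -> R)).
  by apply: measurable_indic; exact: measurable_occ.
apply/funext => eta; rewrite indicE /occ; congr (nat_of_bool _)%:R.
by apply/idP/idP => [h|]; [rewrite inE | rewrite inE].
Qed.

(** Induction on the list of relevant sites: [f] is split according to the value at one site [x],
    and the two restrictions [f (upd true _)] and [f (upd false _)] depend on the remaining
    sites. *)
Lemma tame_local m f : local_on m f -> tame f.
Proof.
move=> /(fun h => ex_intro _ m h) /is_localP[A]; elim: A f => [|x A ih] f fA.
  rewrite (_ : f = fun=> f (fun=> false)); first exact: tame_cst.
  by apply/funext => eta; exact: fA.
pose upd b : Omega -> Omega := fun eta y => if y == x then b else eta y.
rewrite (_ : f = fun eta => occ R eta x * f (upd true eta) +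
    (1 - occ R eta x) * f (upd false eta)).
  have tu b : tame (fun eta => f (upd b eta)).
    apply: ih => eta xi h; apply: fA => y; rewrite /upd in_cons.
    by case: eqVneq => //= _; exact: h.
  apply: tameD; apply: tameM => //; first exact: tame_occ.
  by apply: tameB; [exact: tame_cst|exact: tame_occ].
apply/funext => eta; rewrite /occ; case E : (eta x) => /=.
  rewrite mul1r subrr mul0r addr0; apply: fA => y _.
  by rewrite /upd; case: eqVneq => // ->.
rewrite mul0r subr0 mul1r add0r; apply: fA => y _.
by rewrite /upd; case: eqVneq => // ->.
Qed.

Lemma tame_uniform_limit f :
  (forall e, 0 < e -> exists2 g, tame g & bounded_by e (fun eta => f eta - g eta)) ->
  tame f.
Proof.
move=> fg; have [h hP] : {h : nat -> Omega -> R &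
    forall n, tame (h n) /\ bounded_by n.+1%:R^-1 (fun eta => f eta - h n eta)}.
  apply: (@choice nat (Omega -> R) (fun n g => tame g /\
    bounded_by n.+1%:R^-1 (fun eta => f eta - g eta))) => n.
  by have [|g tg fgn] := fg n.+1%:R^-1; [rewrite invr_gt0|exists g].
split; last first.
  have [[_ [M hM]] f0] := hP 0; exists (M + 1) => eta.
  rewrite -[f eta](subrK (h 0 eta)) addrC.
  apply: le_trans (ler_normD _ _) _; rewrite lerD//.
  by have := f0 eta; rewrite invr1.
apply: (@measurable_fun_cvg _ OmegaM _ _ h) => [n|eta _].
  by have [[]] := hP n.
apply/cvgrPdist_le => e e0; near=> n.
have [_ /(_ eta) hn] := hP n; apply: le_trans hn _.
apply: ltW; near: n; exact: (near_infty_natSinv_lt (PosNum e0)).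
Unshelve. all: by end_near. Qed.

Lemma eq_expect f g : f =1 g -> expect f = expect g.
Proof. by move=> /funext ->. Qed.

Lemma expectD f g : tame f -> tame g ->
  expect (fun eta => f eta + g eta) = expect f + expect g.
Proof. by move=> tf tg; apply: RintegralD => //; exact: tame_integrable. Qed.

Lemma expectB f g : tame f -> tame g ->
  expect (fun eta => f eta - g eta) = expect f - expect g.
Proof. by move=> tf tg; apply: RintegralB => //; exact: tame_integrable. Qed.

Lemma expectZ a f : tame f -> expect (fun eta => a * f eta) = a * expect f.
Proof. by move=> tf; apply: RintegralZl => //; exact: tame_integrable. Qed.

Lemma expect_cst c : expect (fun=> c) = c.
Proof. rewrite /expect Rintegral_cst//.
rewrite -[RHS]mulr1; congr (_ * _); exact: (congr1 fine (probability_setT mu)). Qed.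

Lemma expect_sum (I : Type) (r : seq I) (F : I -> Omega -> R) :
  (forall i, tame (F i)) ->
  expect (fun eta => \sum_(i <- r) F i eta) = \sum_(i <- r) expect (F i).
Proof.
move=> tF; elim: r => [|i r ih].
  by rewrite big_nil; under eq_expect do rewrite big_nil; exact: expect_cst.
rewrite big_cons -ih -expectD//; last exact: tame_sum.
by apply: eq_expect => eta; rewrite big_cons.
Qed.

Lemma expect_ge0 f : (forall eta, 0 <= f eta) -> 0 <= expect f.
Proof. by move=> f0; apply: Rintegral_ge0. Qed.

Lemma le_expect f g : tame f -> tame g -> (forall eta, f eta <= g eta) ->
  expect f <= expect g.
Proof.
by move=> tf tg fg; apply: le_Rintegral => //; exact: tame_integrable.
Qed.

Lemma expect_norm_le M f : tame f -> bounded_by M f -> `|expect f| <= M.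
Proof.
move=> tf fM; rewrite ler_norml; apply/andP; split.
  rewrite -[- M]expect_cst; apply: le_expect => //; first exact: tame_cst.
  by move=> eta; have := fM eta; rewrite ler_norml => /andP[].
rewrite -[leRHS]expect_cst; apply: le_expect => //; first exact: tame_cst.
by move=> eta; have := fM eta; rewrite ler_norml => /andP[].
Qed.
End Expectation.

(** * Invariance of the product measure under relabelling of sites *)

Section BernoulliProduct.
Variables (R : realType) (p : R) (mu : probability OmegaM R).
Hypothesis hmu : bernoulli_product p mu.
Implicit Types (f g : Omega -> R) (eta xi : Omega).

(** These events form a pi-system generating the sigma-algebra, and their probability depends on the
    number of distinct sites alone. *)
Definition occupied_on (A : seq int) : set (int -> bool) :=
  [set eta | forall x, x \in A -> eta x].

Lemma occupied_onE A : mu (occupied_on A) = (p ^+ size (undup A))%:E.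
Proof.
have := hmu (fun=> true) (undup_uniq A).
rewrite big_const_seq count_predT iter_mulr_1 => <-; congr (mu _).
by apply/seteqP; split => eta h x; have := h x; rewrite mem_undup.
Qed.

Lemma measurable_occupied_on A : measurable (occupied_on A : set OmegaM).
Proof.
elim: A => [|x A ih].
  by rewrite (_ : occupied_on [::] = setT)//; apply/seteqP; split.
rewrite (_ : occupied_on _ = [set eta : OmegaM | eta x] `&` occupied_on A).
  by apply: measurableI => //; exact: measurable_occ.
apply/seteqP; split => [eta h|eta [h1 h2] y].
  by split=> [|y yA]; apply: h; rewrite in_cons ?eqxx// yA orbT.
by rewrite in_cons => /orP[/eqP->|]//; exact: h2.
Qed.

(** Exchanges and translations are both of this form, so one invariance proof serves for the two. *)
Definition relabel (pi : int -> int) (eta : Omega) : Omega := fun y => eta (pi y).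

Lemma measurable_relabel pi :
  measurable_fun setT (relabel pi : OmegaM -> OmegaM).
Proof.
apply: (@measurability _ _ OmegaM OmegaM setT (relabel pi) one_site_events) => //.
move=> _ [_ [x _ <-] <-]; rewrite setTI; exact: (measurable_occ (pi x)).
Qed.

Lemma tame_relabel pi f : tame f -> tame (fun eta => f (relabel pi eta)).
Proof.
move=> [mf [M fM]]; split; last by exists M => eta.
exact: (measurableT_comp mf (measurable_relabel pi)).
Qed.

(** The preimage of [occupied_on B] is [occupied_on (map pi B)], which has the same number of
    distinct sites because [pi] is injective. The image measure thus agrees with [mu] on a
    generating pi-system, hence everywhere. *)
Lemma expect_relabel pi f : injective pi -> tame f ->
  expect mu (fun eta => f (relabel pi eta)) = expect mu f.
Proof.
move=> pi_inj tf; have mpi := measurable_relabel pi.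
have muE (A : set OmegaM) : measurable A -> pushforward mu (relabel pi : OmegaM -> OmegaM) A = mu A.
  move=> mA; symmetry.
  apply: (@g_sigma_algebra_measure_unique _ _ OmegaM (range occupied_on)
    _ (fun=> setT)) => //=.
  - by move=> _ [B _ <-]; exact: measurable_occupied_on.
  - by move=> _; exists [::] => //; apply/seteqP; split.
  - by rewrite bigcup_const.
  - move=> _ _ [B _ <-] [C _ <-]; exists (B ++ C) => //.
    apply/seteqP; split => eta.
      by move=> h; split=> x xB; apply: h; rewrite mem_cat xB ?orbT.
    by move=> [h1 h2] x; rewrite mem_cat => /orP[/h1|/h2].
  - move=> _ [B _ <-]; rewrite /pushforward.
    rewrite (_ : _ @^-1` _ = occupied_on (map pi B)).
      by rewrite !occupied_onE (undup_map_inj pi_inj) size_map.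
    apply/seteqP; split => eta h x; first by move=> /mapP[y yB ->]; exact: h.
    by move=> xB; apply: h; exact: map_f.
  - by move=> _; rewrite (le_lt_trans (probability_le1 mu measurableT))// ltry.
  - apply: sub_sigma_algebra2 mA => _ [x _ <-]; exists [:: x] => //.
    apply/seteqP; split => eta; first by apply; rewrite inE.
    by move=> h y; rewrite inE => /eqP ->.
rewrite /expect /Rintegral; congr fine.
rewrite -[LHS](integral_pushforward mpi (f := EFin \o f) (D := setT))//.
- by apply: eq_measure_integral => A mA _; exact: muE.
- by have [mf _] := tf; exact/measurable_EFinP.
- by rewrite preimage_setT; apply: tame_integrable; exact: tame_relabel.
Qed.

Definition swap_index (x z : int) : int :=
  if z == x then x + 1 else if z == x + 1 then x else z.

Lemma swap_relabel x eta : swap x eta = relabel (swap_index x) eta.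
Proof.
by apply/funext => z; rewrite swapE /relabel /swap_index; do ![case: ifP => _].
Qed.

Lemma tame_swap x f : tame f -> tame (fun eta => f (swap x eta)).
Proof. by move=> /(tame_relabel (swap_index x)); under eq_fun do rewrite -swap_relabel. Qed.

Lemma tame_shift x f : tame f -> tame (shift_fun x f).
Proof. exact: (tame_relabel (fun y => y - x)). Qed.

Lemma tame_grad x f : tame f -> tame (grad x f).
Proof. by move=> tf; apply: tameB => //; exact: tame_swap. Qed.

Lemma tame_bond_rate x : tame (bond_rate R x).
Proof. by apply: tameB; [exact: tame_cst|apply: tameM; exact: tame_occ]. Qed.

Lemma expect_swap x f : tame f ->
  expect mu (fun eta => f (swap x eta)) = expect mu f.
Proof.
move=> tf; under eq_expect do rewrite swap_relabel; apply: expect_relabel => //.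
by move=> y z; rewrite /swap_index; do ![case: ifPn => /eqP ?] => ?; lia.
Qed.

Lemma expect_shift x f : tame f -> expect mu (shift_fun x f) = expect mu f.
Proof.
move=> tf; rewrite -[RHS](@expect_relabel (fun y => y - x))//.
by move=> y z /addIr.
Qed.

Lemma expect_occ_prod A : uniq A ->
  expect mu (fun eta => \prod_(x <- A) occ R eta x) = p ^+ size A.
Proof.
move=> uA; rewrite /expect /Rintegral.
rewrite (@eq_integral _ _ _ mu _ (EFin \o \1_(occupied_on A))).
  have mA := measurable_occupied_on A.
  rewrite integral_indic// setIT -[in RHS](undup_id uA).
  exact: (congr1 fine (occupied_onE A)).
move=> eta _ /=; congr EFin; rewrite indicE.
have [h|h] := boolP (eta \in occupied_on A).
  rewrite big_seq big1// => x xA; rewrite /occ.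
  by move: h; rewrite inE => ->.
suff [x xA xE] : exists2 x, x \in A & eta x = false.
  by rewrite (big_rem x)//= /occ xE mul0r.
move/negP: h; rewrite inE => h; apply: contrapT => h'; apply: h => x xA.
by apply: contrapT => /negP/negbTE xE; apply: h'; exists x.
Qed.

End BernoulliProduct.

(** * The Dirichlet form and the gradient decomposition of the current *)

Section DirichletForm.
Variables (R : realType) (p : R) (mu : probability OmegaM R).
Hypothesis hmu : bernoulli_product p mu.
Implicit Types (f g h : Omega -> R) (eta xi : Omega).

Local Notation E := (expect mu).

(** The change of variables [swap x] preserves the measure and flips the sign of [h], so the pairing
    of [h] with [g] after the exchange is the opposite of the pairing with [g]. *)
Lemma expect_odd_mul x h g : tame h -> tame g ->
  (forall eta, h (swap x eta) = - h eta) ->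
  E (fun eta => h eta * g eta) = - 2^-1 * E (fun eta => h eta * grad x g eta).
Proof.
move=> th tg hodd.
have ths := tame_swap x th; have tgs := tame_swap x tg.
have e1 : E (fun eta => h eta * g (swap x eta)) = - E (fun eta => h eta * g eta).
  rewrite -(expect_swap hmu x); last exact: tameM.
  rewrite -mulN1r -expectZ; last exact: tameM.
  by apply: eq_expect => eta; rewrite swapK hodd mulN1r mulNr.
under [in RHS]eq_expect do rewrite /grad mulrBr.
rewrite expectB; [|exact: tameM..].
by rewrite e1; field.
Qed.

(** Integration by parts on one bond: [grad x f] is odd under the exchange, and so is its product
    with the even weight [h]. *)
Lemma expect_mul_grad x h f g : tame h -> tame f -> tame g ->
  (forall eta, h (swap x eta) = h eta) ->
  E (fun eta => g eta * (h eta * grad x f eta)) =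
  - 2^-1 * E (fun eta => h eta * (grad x g eta * grad x f eta)).
Proof.
move=> th tf tg hev; have tgf := tame_grad x tf.
transitivity (E (fun eta => (h eta * grad x f eta) * g eta)).
  by apply: eq_expect => eta; rewrite mulrC.
rewrite [LHS](@expect_odd_mul x)//; last 2 first.
- exact: tameM.
- by move=> eta; rewrite /grad hev swapK; ring.
by congr (_ * _); apply: eq_expect => eta; ring.
Qed.

Lemma expect_mul_generator m M f g : local_on m f -> local_on m g -> (m <= M)%N ->
  E (fun eta => g eta * generator f eta) = - 2^-1 * \sum_(i < (2 * M).+2)
    E (fun eta => bond_rate R (bond M i) eta *
                  (grad (bond M i) g eta * grad (bond M i) f eta)).
Proof.
move=> fm gm mM; have tf := tame_local fm; have tg := tame_local gm.
have tgr i : tame (fun eta => bond_rate R (bond M i) eta * grad (bond M i) f eta).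
  by apply: tameM; [exact: tame_bond_rate|exact: tame_grad].
under eq_expect do rewrite (generatorE _ fm mM) mulr_sumr.
rewrite expect_sum => [|i]; last exact: tameM.
rewrite mulr_sumr; apply: eq_bigr => i _; apply: expect_mul_grad => //.
- exact: tame_bond_rate.
- by move=> eta; exact: bond_rate_swap.
Qed.

Lemma generator_symmetric m f g : local_on m f -> local_on m g ->
  E (fun eta => g eta * generator f eta) = E (fun eta => generator g eta * f eta).
Proof.
move=> fm gm; under [RHS]eq_expect do rewrite mulrC.
rewrite (expect_mul_generator fm gm (leqnn m)).
rewrite (expect_mul_generator gm fm (leqnn m)).
by congr (_ * _); apply: eq_bigr => i _; apply: eq_expect => eta; ring.
Qed.

Lemma expect_monomials (l : seq (R * seq int)) : all (fun cA => uniq cA.2) l ->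
  E (fun eta => \sum_(cA <- l) cA.1 * \prod_(x <- cA.2) occ R eta x) =
  \sum_(cA <- l) cA.1 * p ^+ size cA.2.
Proof.
have tp A : tame (fun eta => \prod_(x <- A) occ R eta x).
  elim: A => [|x A ih]; first by under eq_fun do rewrite big_nil; exact: tame_cst.
  by under eq_fun do rewrite big_cons; apply: tameM => //; exact: tame_occ.
move=> /allP ul; rewrite expect_sum => [|cA]; last exact: tameZ.
rewrite big_seq [RHS]big_seq; apply: eq_bigr => cA /ul uA.
by rewrite expectZ// (expect_occ_prod hmu).
Qed.

(** The energy of the nongradient current and the instantaneous term of the Green-Kubo formula both
    have this form. Since occupation numbers are idempotent, everything expands into products over
    distinct sites. *)
Lemma expect_bond_poly (x : int) (k0 k1 k2 : R) :
  E (fun eta => (k0 + k1 * (occ R eta (x - 1) + occ R eta (x + 2)) +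
                 k2 * (occ R eta (x - 1) * occ R eta (x + 2))) *
                (occ R eta x - occ R eta (x + 1)) ^+ 2) =
  (k0 + 2 * k1 * p + k2 * p ^+ 2) * (2 * p * (1 - p)).
Proof.
pose l : seq (R * seq int) :=
  [:: (k0, [:: x]); (k0, [:: x + 1]); (- 2 * k0, [:: x; x + 1]);
      (k1, [:: x - 1; x]); (k1, [:: x - 1; x + 1]);
      (- 2 * k1, [:: x - 1; x; x + 1]);
      (k1, [:: x + 2; x]); (k1, [:: x + 2; x + 1]);
      (- 2 * k1, [:: x + 2; x; x + 1]);
      (k2, [:: x - 1; x + 2; x]); (k2, [:: x - 1; x + 2; x + 1]);
      (- 2 * k2, [:: x - 1; x + 2; x; x + 1])].
rewrite (@eq_expect _ _ _ (fun eta => \sum_(cA <- l) cA.1 * \prod_(y <- cA.2) occ R eta y)).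
  rewrite expect_monomials; first by rewrite /l !big_cons big_nil /=; ring.
  by rewrite /l /= !inE; lia.
move=> eta; rewrite /l !big_cons !big_nil /=.
have sq y : occ R eta y ^+ 2 = occ R eta y.
  by rewrite /occ; case: (eta y); rewrite ?expr1n ?expr0n.
rewrite sqrrB !sq; ring.
Qed.
End DirichletForm.

(** * The current and its gradient part *)

Section Current.
Variables (R : realType).
Implicit Types (f g h : Omega -> R) (eta xi : Omega).

Definition bond_diff (x : int) eta : R := occ R eta x - occ R eta (x + 1).
Definition bond_current x eta : R := bond_rate R x eta * bond_diff x eta.
(** The exchange rate of the porous medium model on the bond [{x, x + 1}]: the number of empty sites
    among the two outer neighbours. *)
Definition holes (x : int) eta : R := 2 - occ R eta (x - 1) - occ R eta (x + 2).

(* The porous medium current [holes x * bond_diff x] is the discrete gradient of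
   this function. *)
Definition potential (x : int) eta : R :=
  2 * occ R eta x - occ R eta (x - 1) * occ R eta x
  - occ R eta x * occ R eta (x + 1) + occ R eta (x - 1) * occ R eta (x + 1).

Lemma potential_grad x eta :
  holes x eta * bond_diff x eta = potential x eta - potential (x + 1) eta.
Proof.
rewrite /holes /bond_diff /potential.
rewrite (_ : x + 1 - 1 = x); last by lia.
rewrite (_ : x + 1 + 1 = x + 2); last by lia.
ring.
Qed.

(** Either both outer sites are occupied and [holes] vanishes, or the rate is 1. This is what lets
    the porous medium current be subtracted inside the factor [bond_rate]. *)
Lemma bond_rate_holes x eta : bond_rate R x eta * holes x eta = holes x eta.
Proof.
rewrite /bond_rate /holes /occ.
by case: (eta _); case: (eta _) => /=; rewrite ?mulr1n ?mulr0n; ring.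
Qed.

Lemma potential_bounded x : bounded_by 5 (potential x).
Proof.
move=> eta; rewrite /potential /occ.
by case: (eta _); case: (eta _); case: (eta _) => /=; rewrite ler_norml; lra.
Qed.

Lemma bond_current_bounded x : bounded_by 1 (bond_current x).
Proof.
move=> eta; rewrite /bond_current /bond_rate /bond_diff /occ.
by case: (eta _); case: (eta _); case: (eta _); case: (eta _) => /=; rewrite ler_norml; lra.
Qed.

Lemma currentE eta : current R eta = 2^-1 * (bond_current 0 eta + bond_current (-1) eta).
Proof.
rewrite /current !big_cons big_nil /= addr0; congr (_ * (_ + _)).
  by rewrite mul1r (rateS _ 0).
rewrite (rateSC _ (-1)) /bond_current /bond_diff; set r := bond_rate _ _ _.
by rewrite (_ : (-1)%:~R = -1 :> R)//= (_ : -1 + 1 = 0 :> int)//; ring.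
Qed.

Lemma shift_bond_current x y eta :
  shift_fun y (bond_current x) eta = bond_current (x - y) eta.
Proof.
rewrite /shift_fun /bond_current /bond_rate /bond_diff /occ /shift_conf.
have e1 : x + 1 - y = x - y + 1 by lia.
have e2 : x + 2 - y = x - y + 2 by lia.
have e3 : x - 1 - y = x - y - 1 by lia.
by rewrite e1 e2 e3.
Qed.

Lemma shift_current x eta : shift_fun x (current R) eta =
  2^-1 * (bond_current (- x) eta + bond_current (- x - 1) eta).
Proof.
rewrite /shift_fun currentE -/(shift_fun x (bond_current 0) eta).
rewrite -/(shift_fun x (bond_current (-1)) eta) !shift_bond_current sub0r.
by rewrite (_ : -1 - x = - x - 1)//; lia.
Qed.

Definition total_current (n : nat) eta : R :=
  \sum_(k < n) shift_fun k%:Z (current R) eta.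

Definition nongradient (lam : R) x eta : R :=
  bond_rate R x eta * ((1 - lam * holes x eta) * bond_diff x eta).

(** The current at a site averages two neighbouring bond currents; replacing it by one of them costs
    a telescoping difference, and the porous medium part telescopes as well. What is left sits at
    the two ends of the block: two bond currents bounded by 1, with weight 1/2, and two potentials
    bounded by 5, with weight [lam]. *)
Lemma total_currentE lam n : exists2 r : Omega -> R,
  bounded_by (1 + 10 * `|lam|) r &
  forall eta, total_current n eta = \sum_(k < n) nongradient lam (- k%:Z) eta + r eta.
Proof.
exists (fun eta => - 2^-1 * (bond_current 0 eta - bond_current (- n%:Z) eta) +
    lam * (potential (- n%:Z + 1) eta - potential 1 eta)) => eta; last first.
  have sk k : shift_fun k%:Z (current R) eta = nongradient lam (- k%:Z) eta
      - 2^-1 * (bond_current (- k%:Z) eta - bond_current (- k.+1%:Z) eta)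
      + lam * (potential (- k%:Z) eta - potential (- k%:Z + 1) eta).
    rewrite shift_current (_ : - k%:Z - 1 = - k.+1%:Z); last by lia.
    rewrite -potential_grad -bond_rate_holes.
    by rewrite /nongradient {1 3}/bond_current; field.
  elim: n => [|n ih].
    by rewrite /total_current !big_ord0 (_ : - 0%:Z = 0)// ?add0r; ring.
  rewrite /total_current !big_ord_recr /= -/(total_current n eta) ih sk.
  by rewrite (_ : - n.+1%:Z + 1 = - n%:Z); [ring|lia].
have := bond_current_bounded 0 eta; set a := bond_current 0 eta => ha.
have := bond_current_bounded (- n%:Z) eta; set b := bond_current _ eta => hb.
have := potential_bounded (- n%:Z + 1) eta; set c := potential _ eta => hc.
have := potential_bounded 1 eta; set d := potential _ eta => hd.
apply: le_trans (ler_normD _ _) _; apply: lerD.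
  by rewrite normrM normrN (@ger0_norm _ 2^-1)//; have := ler_normB a b; lra.
by rewrite normrM mulrC ler_wpM2r//; have := ler_normB c d; lra.
Qed.
End Current.

Arguments bond_diff {R}.
Arguments bond_current {R}.
Arguments holes {R}.
Arguments potential {R}.
Arguments total_current {R}.

(** * The variational bound for local test functions *)

Section StaticBound.
Variables (R : realType) (p : R) (mu : probability OmegaM R).
Hypothesis hmu : bernoulli_product p mu.
Implicit Types (f g h : Omega -> R) (eta xi : Omega).

Local Notation E := (expect mu).

(** The weight [c (1 - lam c')^2] equals [a] when both outer sites are empty and [a + b] when
    exactly one is occupied; the coefficient [-(a + 2 b)] makes it vanish when both are. *)
Definition nongradient_energy (lam : R) : R :=
  let a := (1 - 2 * lam) ^+ 2 in
  let b := 2 * lam - 3 * lam ^+ 2 in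
  (a + 2 * b * p - (a + 2 * b) * p ^+ 2) * (2 * p * (1 - p)).

Lemma tame_bond_diff x : tame (bond_diff x : Omega -> R).
Proof. by apply: tameB; exact: tame_occ. Qed.

Lemma tame_holes x : tame (holes x : Omega -> R).
Proof.
by apply: tameB; [apply: tameB; [exact: tame_cst|exact: tame_occ]|exact: tame_occ].
Qed.

Lemma expect_nongradient_sq lam (x : int) :
  E (fun eta => bond_rate R x eta *
    ((1 - lam * holes x eta) * bond_diff x eta) ^+ 2) = nongradient_energy lam.
Proof.
rewrite /nongradient_energy; set a := (1 - 2 * lam) ^+ 2.
set b := 2 * lam - 3 * lam ^+ 2.
rewrite -mulNr -(expect_bond_poly hmu x); apply: eq_expect => eta.
rewrite exprMn [LHS]mulrA; congr (_ * _); rewrite /bond_rate /holes /occ /a /b.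
by case: (eta _); case: (eta _) => /=; ring.
Qed.

(** By oddness the pairing is [-1/2] times the expectation of [r u v], where [u] is the odd factor
    of the current and [v] the gradient of [g]; then [-2 u v <= u^2 + v^2]. *)
Lemma expect_nongradient_le lam x g : tame g ->
  E (fun eta => nongradient lam x eta * g eta) <= 4^-1 * nongradient_energy lam +
  4^-1 * E (fun eta => bond_rate R x eta * (grad x g eta * grad x g eta)).
Proof.
move=> tg; have tr := tame_bond_rate R x; have tgr := tame_grad x tg.
have td := tame_bond_diff x; have th := tame_holes x.
have tv : tame (fun eta => (1 - lam * holes x eta) * bond_diff x eta).
  by apply: tameM => //; apply: tameB; [exact: tame_cst|exact: tameZ].
have tn : tame (nongradient lam x) by exact: tameM.
rewrite (expect_odd_mul hmu (x := x)) // => [|eta]; last first.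
  rewrite /nongradient bond_rate_swap /holes /bond_diff /occ !swapE !eqxx.
  have e1 : (x - 1 == x) = false by apply/eqP; lia.
  have e2 : (x - 1 == x + 1) = false by apply/eqP; lia.
  have e3 : (x + 2 == x) = false by apply/eqP; lia.
  have e4 : (x + 2 == x + 1) = false by apply/eqP; lia.
  have e5 : (x + 1 == x) = false by apply/eqP; lia.
  by rewrite e1 e2 e3 e4 e5; ring.
rewrite -(expect_nongradient_sq lam x) -mulrDr -expectD; last 2 first.
- by apply: tameM => //; exact: tameM.
- by apply: tameM => //; exact: tameM.
rewrite -!expectZ; last 2 first.
- by apply: tameD; apply: tameM => //; exact: tameM.
- exact: tameM.
apply: le_expect => [||eta].
- by apply: tameZ; exact: tameM.
- by apply: tameZ; apply: tameD; apply: tameM => //; exact: tameM.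
rewrite /nongradient; have := bond_rate_ge0 R x eta.
set r := bond_rate _ _ _; set u := _ * bond_diff _ _; set v := grad _ _ _ => r0.
rewrite -subr_ge0 (_ : _ - _ = 4^-1 * (r * (u + v) ^+ 2)); last by field.
by rewrite mulr_ge0// mulr_ge0// sqr_ge0.
Qed.

(** The one-bond estimate is summed over the block. A quarter of the sum of the bond energies of [g]
    over all bonds equals [-1/2] times the expectation of [g] against [generator g], and restricting
    to the block only decreases it. *)
Lemma total_current_static_bound (lam d : R) n m g : local_on m g -> 0 < d ->
  E (fun eta => total_current n eta * g eta) <=
  n%:R * nongradient_energy lam / 4 + (1 + 10 * `|lam|) ^+ 2 / (4 * d)
  + d * E (fun eta => g eta ^+ 2) - 2^-1 * E (fun eta => g eta * generator g eta).
Proof.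
move=> gm d0; have tg := tame_local gm.
have [r rb rE] := total_currentE lam n.
have tn k : tame (nongradient lam (- k%:Z)).
  have td := tame_bond_diff (- k%:Z); have th := tame_holes (- k%:Z).
  apply: tameM; first exact: tame_bond_rate.
  by apply: tameM => //; apply: tameB; [exact: tame_cst|exact: tameZ].
have ts : tame (fun eta => \sum_(k < n) nongradient lam (- k%:Z) eta).
  exact: tame_sum.
have tb x : tame (bond_current x : Omega -> R).
  by apply: tameM; [exact: tame_bond_rate|exact: tame_bond_diff].
have tJ : tame (total_current n : Omega -> R).
  apply: tame_sum => k; rewrite (_ : shift_fun _ _ = fun eta => 2^-1 *
      (bond_current (- k%:Z) eta + bond_current (- k%:Z - 1) eta)).
    by apply: tameZ; exact: tameD.
  by apply/funext => eta; exact: shift_current.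
have tr : tame r.
  rewrite (_ : r = fun eta => total_current n eta
    - \sum_(k < n) nongradient lam (- k%:Z) eta); first exact: tameB.
  by apply/funext => eta; rewrite rE addrC addKr.
under eq_expect do rewrite rE mulrDl.
rewrite expectD; [|exact: tameM..].
(* AM-GM with weight [d]: the boundary remainder costs a constant independent of [n], plus [d] times
   the squared norm of [g]. *)
have rg : E (fun eta => r eta * g eta) <=
    (1 + 10 * `|lam|) ^+ 2 / (4 * d) + d * E (fun eta => g eta ^+ 2).
  have tg2 : tame (fun eta => g eta ^+ 2) by exact: tameM.
  rewrite -expectZ// -[X in _ <= X + _](expect_cst mu) -expectD//; last 2 first.
  - exact: tame_cst.
  - exact: tameZ.
  apply: le_expect => [||eta]; first exact: tameM.
    by apply: tameD; [exact: tame_cst|exact: tameZ].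
  have := rb eta; set K := 1 + _ => rK.
  have : r eta ^+ 2 <= K ^+ 2.
    by rewrite -real_normK ?num_real// lerXn2r ?nnegrE// (le_trans _ rK).
  rewrite -subr_ge0 => K2; rewrite -subr_ge0.
  rewrite (_ : _ - _ = (K ^+ 2 - r eta ^+ 2) / (4 * d)
    + (r eta - 2 * d * g eta) ^+ 2 / (4 * d)); last by field; lra.
  by rewrite addr_ge0// divr_ge0// ?sqr_ge0//; lra.
suff sg : E (fun eta => (\sum_(k < n) nongradient lam (- k%:Z) eta) * g eta) <=
    n%:R * nongradient_energy lam / 4 - 2^-1 * E (fun eta => g eta * generator g eta).
  by move: rg sg; lra.
under eq_expect do rewrite mulr_suml.
rewrite expect_sum => [|k]; last exact: tameM.
pose e x := E (fun eta => bond_rate R x eta * (grad x g eta * grad x g eta)).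
have e0 x : 0 <= e x.
  by apply: expect_ge0 => eta; rewrite mulr_ge0 ?bond_rate_ge0// -expr2 sqr_ge0.
apply: (@le_trans _ _ (\sum_(k < n) (4^-1 * nongradient_energy lam + 4^-1 * e (- k%:Z)))).
  by apply: ler_sum => k _; exact: expect_nongradient_le.
rewrite big_split/= sumr_const card_ord -mulr_sumr -mulr_natl.
pose M := maxn m n.
rewrite (expect_mul_generator hmu gm gm (leq_maxl m n)) -/M.
(* Read backwards, the enumeration [bond M] lists [M, M - 1, ...], so the block
   [0, -1, ..., -(n - 1)] occupies the positions from [M] to [M + n - 1]. The other terms are
   nonnegative. *)
have : \sum_(k < n) e (- k%:Z) <= \sum_(i < (2 * M).+2) e (bond M i).
  have nM : (n <= M)%N by rewrite /M leq_maxr.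
  rewrite -(big_mkord xpredT (fun k => e (- k%:Z))).
  rewrite -(big_mkord xpredT (fun i => e (bond M i))) [leRHS]big_nat_rev/= add0n.
  rewrite [leRHS](@big_cat_nat _ _ _ M)//=; last by lia.
  rewrite [X in _ <= _ + X](@big_cat_nat _ _ _ (M + n))//=; [|lia..].
  have -> : \sum_(0 <= k < n) e (- k%:Z) =
      \sum_(M <= j < M + n) e (bond M ((2 * M).+2 - j.+1)).
    rewrite -{1}[M]add0n [(M + n)%N]addnC big_addn addnK.
    by apply: eq_big_nat => k kn; congr e; rewrite /bond; lia.
  rewrite addrCA lerDl; apply: addr_ge0; apply: sumr_ge0 => *; exact: e0.
rewrite /e; set X := \sum_(_ < _) _; set Y := \sum_(_ < _) _ => XY.
by rewrite -subr_ge0; move: XY; lra.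
Qed.

End StaticBound.

(** * Taylor expansion of the semigroup *)

Section RemainderGrowth.
Variable R : realType.

Lemma power_is_derive (K : nat) (s : R) :
  is_derive s 1 (fun s : R => s ^+ K.+1 / K.+1`!%:R) (s ^+ K / K`!%:R).
Proof.
have := is_deriveZ (K.+1`!%:R^-1 : R) (is_deriveX K.+1 (is_derive_id s (1 : R))).
rewrite (_ : _ \*: _ = fun s : R => s ^+ K.+1 / K.+1`!%:R); last first.
  by apply/funext => t; rewrite fctE /= mulrC.
move=> h; apply: is_derive_eq; rewrite /GRing.scale/= mulr1 factS natrM.
by field; rewrite pnatr_eq0 -lt0n fact_gt0 /= addrC natr1 pnatr_eq0.
Qed.

(** One integration of a bound on the derivative, carried out by the mean value theorem. Only right
    continuity is asked at 0, since the semigroup is constrained for nonnegative times. *)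
Lemma remainder_growth (phi dphi : R -> R) (K : nat) (N : R) :
  phi 0 = 0 -> phi x @[x --> 0^'+] --> 0 ->
  (forall s : R, 0 < s -> is_derive s 1 phi (dphi s)) ->
  (forall s : R, 0 < s -> `|dphi s| <= N * (s ^+ K / K`!%:R)) ->
  forall T : R, 0 <= T -> `|phi T| <= N * (T ^+ K.+1 / K.+1`!%:R).
Proof.
move=> phi0 phic dphiE dphile T; rewrite le_eqVlt => /orP[/eqP<-|T0].
  by rewrite phi0 normr0 expr0n mul0r mulr0.
(* Both signs of [phi] are treated at once, [b] being 1 or -1. *)
suff main (b : R) : b ^+ 2 = 1 -> b * phi T <= N * (T ^+ K.+1 / K.+1`!%:R).
  rewrite ler_norml; apply/andP; split.
    by have := main (-1) ltac:(ring); rewrite mulN1r lerNl.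
  by have := main 1 ltac:(ring); rewrite mul1r.
move=> b2; have nb : `|b| = 1 by apply/eqP; rewrite -sqrp_eq1// real_normK ?num_real// b2.
pose G s := N * (s ^+ K.+1 / K.+1`!%:R) - b * phi s.
have GE (s : R) : 0 < s -> is_derive s 1 G (N * (s ^+ K / K`!%:R) - b * dphi s).
  move=> s0; have h1 := dphiE s s0; have h2 := power_is_derive K s.
  apply: is_derive_eq; by rewrite /GRing.scale/=; ring.
have Gc (s : R) : 0 < s -> {for s, continuous G}.
  by move=> /GE [dG _]; apply/differentiable_continuous/derivable1_diffP.
have [||c] := @MVT R G (fun s => N * (s ^+ K / K`!%:R) - b * dphi s) 0 T T0.
- by move=> s; rewrite in_itv /= => /andP[s0 _]; exact: GE.
- apply/continuous_within_itvP => //; split.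
  + by move=> s; rewrite in_itv /= => /andP[s0 _]; exact: Gc.
  + rewrite {2}/G phi0; apply: cvgB; last by apply: cvgM => //; exact: cvg_cst.
    apply: cvg_at_right_filter.
    have [dp _] := power_is_derive K (0 : R).
    have dc : {for 0 : R, continuous (fun s : R => s ^+ K.+1 / K.+1`!%:R)}.
      by apply/differentiable_continuous/derivable1_diffP.
    by apply: cvgM; [exact: cvg_cst|exact: dc].
  + by apply: cvg_at_left_filter; exact: Gc.
rewrite in_itv /= => /andP[c0 cT]; rewrite subr0.
rewrite {2}/G phi0 mulr0 subr0 expr0n mul0r mulr0 subr0 /G => GT.
rewrite -subr_ge0 GT.
rewrite mulr_ge0 ?(ltW T0)// subr_ge0; apply: le_trans (dphile c c0).
by rewrite (le_trans (ler_norm _))// normrM nb mul1r.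
Qed.
End RemainderGrowth.

Lemma bin_leq_exp2 n k : ('C(n, k) <= 2 ^ n)%N.
Proof.
elim: n k => [|n ih] [|k] //; first by rewrite bin0 expn_gt0.
by rewrite binS expnS mul2n -addnn leq_add.
Qed.

Section Semigroup.
Variables (R : realType) (S : R -> (Omega -> R) -> Omega -> R).
Hypotheses (hS : markov_semigroup S) (hL : generated_by S (@generator R)).
Implicit Types (f g u v : Omega -> R) (eta xi : Omega).

Lemma continuous_comb a f g : continuous f -> continuous g ->
  continuous (fun eta => a * f eta + g eta).
Proof.
by move=> cf cg eta; apply: cvgD; [apply: cvgM; [exact: cvg_cst|exact: cf]|exact: cg].
Qed.
Arguments continuous_comb : clear implicits.
Arguments continuous_comb a {f g}.

Lemma continuous_const (c : R) : continuous (fun _ : Omega => c).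
Proof. by move=> eta; exact: cvg_cst. Qed.
Arguments continuous_const : clear implicits.

Lemma continuous_scale a f : continuous f -> continuous (fun eta => a * f eta).
Proof. by move=> cf eta; apply: cvgM; [exact: cvg_cst|exact: cf]. Qed.
Arguments continuous_scale : clear implicits.
Arguments continuous_scale a {f}.

Lemma semigroup_comb t a f g eta : 0 <= t -> continuous f -> continuous g ->
  S t (fun eta => a * f eta + g eta) eta = a * S t f eta + S t g eta.
Proof. by move=> t0 cf cg; rewrite (semigroup_linear hS). Qed.

Lemma semigroup_cst t c eta : 0 <= t -> S t (fun=> c) eta = c.
Proof.
move=> t0; rewrite (_ : (fun=> c) = fun _ : Omega => (c - 1) * 1 + 1); last first.
  by apply/funext => xi; rewrite mulr1 subrK.
rewrite (semigroup_comb _ _ t0 (continuous_const 1) (continuous_const 1)).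
by rewrite (semigroup1 hS t0); ring.
Qed.

Lemma semigroup_scale t a f eta : 0 <= t -> continuous f ->
  S t (fun eta => a * f eta) eta = a * S t f eta.
Proof.
move=> t0 cf; have := semigroup_comb a eta t0 cf (continuous_const 0).
rewrite semigroup_cst// addr0 => <-; congr (S t _ _).
by apply/funext => xi; rewrite addr0.
Qed.

(** Positivity and preservation of constants, applied to [M + f] and [M - f]. *)
Lemma semigroup_contract t f M : 0 <= t -> continuous f -> bounded_by M f ->
  bounded_by M (S t f).
Proof.
move=> t0 cf fM eta.
have cM := continuous_const M.
have h1 := semigroup_comb (-1) eta t0 cf cM.
have h2 := semigroup_comb 1 eta t0 cf cM.
rewrite semigroup_cst// in h1; rewrite semigroup_cst// in h2.
rewrite ler_norml; apply/andP; split.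
  suff : 0 <= S t (fun eta => 1 * f eta + M) eta by rewrite h2; lra.
  apply: (semigroup_ge0 hS) => //; first exact: continuous_comb.
  by move=> xi; have := fM xi; rewrite ler_norml => /andP[]; lra.
suff : 0 <= S t (fun eta => -1 * f eta + M) eta by rewrite h1; lra.
apply: (semigroup_ge0 hS) => //; first exact: continuous_comb.
by move=> xi; have := fM xi; rewrite ler_norml => /andP[]; lra.
Qed.

(** Contraction in the shape needed for difference quotients, where [S t] is factored out of a
    combination of three functions. *)
Lemma semigroup_contract3 t a b c f g u e : 0 <= t ->
  continuous f -> continuous g -> continuous u ->
  bounded_by e (fun eta => a * f eta + (b * g eta + c * u eta)) ->
  bounded_by e (fun eta => a * S t f eta + (b * S t g eta + c * S t u eta)).
Proof.
move=> t0 cf cg cu h eta; have cc := continuous_scale c cu.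
have := semigroup_contract t0 (continuous_comb a cf (continuous_comb b cg cc)) h eta.
by rewrite semigroup_comb ?semigroup_comb ?semigroup_scale//; exact: continuous_comb.
Qed.

Lemma semigroup_near t f g e : 0 <= t -> continuous f -> continuous g ->
  bounded_by e (fun eta => f eta - g eta) ->
  bounded_by e (fun eta => S t f eta - S t g eta).
Proof.
move=> t0 cf cg h eta.
have := @semigroup_contract3 t 1 (-1) 0 f g g e t0 cf cg cg _ eta.
rewrite mul0r addr0 mul1r mulN1r; apply=> xi.
by rewrite mul0r addr0 mul1r mulN1r; exact: h.
Qed.

Lemma generator_near0 m f e : local_on m f -> 0 < e -> exists2 d, 0 < d &
  forall h, 0 < h -> h < d ->
  bounded_by e (fun eta => h^-1 * (S h f eta - f eta) - generator f eta).
Proof.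
move=> fm e0; have fl : is_local f by apply/is_localP; exists m.
have := hL fl => /(_ [set g | bounded_by e (fun eta => g eta - generator f eta)]).
case.
  apply/uniform_nbhs; exists [set xy : R * R | ball xy.1 e xy.2]; split.
    exact: (@entourage_ball R R (PosNum e0)).
  by move=> g /= h eta; rewrite distrC ltW//; have := h eta I; rewrite -ball_normE.
move=> d /= d0 hd; exists d => // h h0 hd'.
by apply: hd => //=; rewrite sub0r normrN gtr0_norm.
Qed.

Lemma local_bounded m f : local_on m f -> exists2 M, 0 <= M & bounded_by M f.
Proof.
move=> fm; have [_ [M fM]] := tame_local fm; exists M => //.
by apply: le_trans (fM (fun=> false)).
Qed.

Lemma semigroup_near0 m f e : local_on m f -> 0 < e -> exists2 d, 0 < d &
  forall h, 0 < h -> h < d -> bounded_by e (fun eta => S h f eta - f eta).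
Proof.
move=> fm e0; have [d d0 hd] := generator_near0 fm ltr01.
have [M M0 LM] := local_bounded (local_on_generator fm).
exists (Num.min d (e / (M + 1))).
  by rewrite lt_min d0 divr_gt0// ltr_wpDl.
move=> h h0; rewrite lt_min => /andP[hd1 hd2] eta.
have := hd _ h0 hd1 eta; have := LM eta; set x := S h f eta - f eta.
set l := generator f eta => lM xl.
have -> : x = h * (h^-1 * x - l + l) by field; rewrite gt_eqF.
rewrite normrM gtr0_norm//; apply: (@le_trans _ _ (h * (1 + M))).
  by rewrite ler_pM2l// (le_trans (ler_normD _ _))// lerD.
by rewrite addrC -ler_pdivlMr ?ltW// ltr_wpDl.
Qed.

(** For positive increments, [S s] is factored out and the generator at time 0 is used. The
    two-sided derivative also needs negative increments, for which strong continuity on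
    [generator f] enters. *)
Lemma semigroup_is_derive m f eta (s : R) : local_on m f -> 0 < s ->
  is_derive s 1 (fun s => S s f eta) (S s (generator f) eta).
Proof.
move=> fm s0; have cf := local_on_continuous fm.
have Lm := local_on_generator fm; have cL := local_on_continuous Lm.
suff H : h^-1 *: (((fun s => S s f eta) \o shift s) (h *: 1) - S s f eta)
    @[h --> (0 : R)^'] --> S s (generator f) eta.
  by split; [apply/cvg_ex; exists (S s (generator f) eta)|exact/cvg_lim].
apply/cvgrPdist_le => e e0; have e20 : 0 < e / 2 by rewrite divr_gt0.
have [d1 d10 hd1] := generator_near0 fm e20.
have [d2 d20 hd2] := semigroup_near0 Lm e20.
near=> h.
have hn0 : h != 0 by near: h; exact: nbhs_dnbhs_neq.
have hd : `|h| < Num.min (Num.min d1 d2) s.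
  by near: h; apply: dnbhs0_lt; rewrite !lt_min d10 d20 s0.
move: hd; rewrite !lt_min => /andP[/andP[h1 h2] h3].
rewrite /= /GRing.scale/= mulr1; case: (ltgtP h 0) hn0 => // h0 _.
  (* With [k = - h], the operator [S (s - k)] is factored out by writing [s] as [(s - k) + k]; this
     leaves [S k (generator f)] minus the difference quotient at time [k], and both are close to
     [generator f]. *)
  have k0 : 0 < - h by rewrite oppr_gt0.
  move: h1 h2 h3; rewrite ltr0_norm// => h1 h2 h3; set k := - h in k0 h1 h2 h3.
  have sk : 0 <= s - k by rewrite subr_ge0 ltW.
  have ck := semigroup_continuous hS (ltW k0) cf.
  have ckL := semigroup_continuous hS (ltW k0) cL.
  rewrite (_ : h + s = s - k); last by rewrite /k; lra.
  rewrite (_ : s = (s - k) + k) 1?{1}(_ : s = (s - k) + k); [|lra..].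
  rewrite (_ : (s - k + k - k) = s - k); last lra.
  rewrite !(semigroupD hS _ (ltW k0))//.
  have := @semigroup_contract3 (s - k) 1 (- k^-1) (k^-1) (S k (generator f)) (S k f) f e
    sk ckL ck cf _ eta.
  rewrite (_ : h = - k); last by rewrite /k opprK.
  rewrite invrN => H; rewrite (_ : _ - _ = 1 * S (s - k) (S k (generator f)) eta +
    (- k^-1 * S (s - k) (S k f) eta + k^-1 * S (s - k) f eta)); last by ring.
  apply: H => xi; have := hd1 _ k0 h1 xi; have := hd2 _ k0 h2 xi.
  set a := S k (generator f) xi - _; set b := _ - _ => ha hb.
  rewrite (_ : _ + _ = a - b); last by rewrite /a /b; ring.
  by apply: le_trans (ler_normB _ _) _; rewrite (splitr e) lerD.
rewrite gtr0_norm// in h1 h2 h3.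
rewrite (addrC h) (semigroupD hS (ltW s0) (ltW h0))//.
have ch := semigroup_continuous hS (ltW h0) cf.
have := @semigroup_contract3 s 1 (- h^-1) (h^-1) (generator f) (S h f) f e
    (ltW s0) cL ch cf _ eta.
move=> H; rewrite (_ : _ - _ = 1 * S s (generator f) eta +
    (- h^-1 * S s (S h f) eta + h^-1 * S s f eta)); last by ring.
apply: H => xi; have := hd1 _ h0 h1 xi; rewrite -normrN => hb.
rewrite (_ : _ + _ = - (h^-1 * (S h f xi - f xi) - generator f xi)); last by ring.
by apply: le_trans hb _; rewrite ler_pdivrMr// ler_peMr ?ltW// ltr1n.
Unshelve. all: by end_near. Qed.

Definition taylor (K : nat) (s : R) f : Omega -> R := fun eta =>
  \sum_(k < K) (s ^+ k / k`!%:R) * iter k (@generator R) f eta.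

Lemma taylor_is_derive K (s : R) f eta :
  is_derive s 1 (fun s : R => taylor K.+1 s f eta) (taylor K s (generator f) eta).
Proof.
have -> : (fun s => taylor K.+1 s f eta) = cst (f eta) +
    \sum_(k < K) (iter k.+1 (@generator R) f eta \*:
      (fun s : R => s ^+ k.+1 / k.+1`!%:R)).
  apply/funext => t; rewrite /taylor big_ord_recl /= expr0 divr1 mul1r fctE/=.
  by congr (_ + _); rewrite fct_sumE; apply: eq_bigr => k _; rewrite /GRing.scale/= mulrC.
have h (k : 'I_K) : is_derive s 1 (iter k.+1 (@generator R) f eta \*:
      (fun s : R => s ^+ k.+1 / k.+1`!%:R)) (iter k.+1 (@generator R) f eta *:
      (s ^+ k / k`!%:R)).
  by apply: is_deriveZ; exact: power_is_derive.
have := is_deriveD (is_derive_cst (f eta) s 1) (is_derive_sum h).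
move=> H; apply: is_derive_eq; rewrite add0r /taylor; apply: eq_bigr => k _.
by rewrite /GRing.scale/= mulrC -iterSr.
Qed.

(** Induction on [K]: the time derivative of the remainder of order [K + 1] of [f] is the remainder
    of order [K] of [generator f], and [remainder_growth] integrates it. *)
Lemma taylor_remainder K m f N : local_on m f ->
  bounded_by N (iter K (@generator R) f) -> forall s, 0 <= s ->
  bounded_by (N * (s ^+ K / K`!%:R)) (fun eta => S s f eta - taylor K s f eta).
Proof.
elim: K m f => [|K ih] m f fm fN s s0 eta.
  rewrite /taylor big_ord0 subr0 expr0 divr1 mulr1.
  by apply: semigroup_contract => //; exact: local_on_continuous fm.
apply: (@remainder_growth _ (fun s => S s f eta - taylor K.+1 s f eta)
  (fun s => S s (generator f) eta - taylor K s (generator f) eta)) => //.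
- rewrite (semigroup0 hS); last exact: local_on_continuous fm.
  rewrite /taylor big_ord_recl big1 => [|k _]; last by rewrite expr0n /= !mul0r.
  by rewrite expr0 divr1 mul1r addr0 subrr.
- have t0 : taylor K.+1 0 f eta = f eta.
    rewrite /taylor big_ord_recl big1 => [|k _]; last by rewrite expr0n /= !mul0r.
    by rewrite expr0 divr1 mul1r addr0.
  rewrite -[X in _ --> X](subrr (f eta)) -{2}t0; apply: cvgB.
    apply/cvgrPdist_le => e e0; have [d d0 hd] := semigroup_near0 fm e0.
    by near=> h; rewrite distrC; apply: hd.
  apply: cvg_at_right_filter; have [dT _] := taylor_is_derive K 0 f eta.
  by apply/differentiable_continuous/derivable1_diffP.
- move=> t t0; have h1 := semigroup_is_derive eta fm t0.
  have h2 := taylor_is_derive K t f eta; exact: is_deriveB.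
- move=> t t0; apply: (ih _ _ (local_on_generator fm) _ _ (ltW t0)).
  by rewrite -iterSr.
Unshelve. all: by end_near. Qed.

Lemma local_on_iter_generator m k f : local_on m f ->
  local_on (m + 2 * k) (iter k (@generator R) f).
Proof.
move=> fm; elim: k => [|k ih] /=; first by rewrite muln0 addn0.
by rewrite mulnS addnCA; exact: local_on_generator.
Qed.

(** The j-th application acts at radius [m + 2 j] and costs the factor
    [4 (m + 2 j + 1) <= 8 (m + j + 1)]; the product of the numbers [m + j + 1] for [j < k] is [k!]
    times the binomial coefficient. *)
Lemma bounded_by_iter_generator m k f C : local_on m f -> bounded_by C f ->
  bounded_by (8 ^+ k * k`!%:R * 'C(m + k, k)%:R * C) (iter k (@generator R) f).
Proof.
move=> fm fC; have C0 : 0 <= C by apply: le_trans (fC (fun=> false)).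
elim: k => [|k ih] eta; first by rewrite bin0 !mul1r.
rewrite iterS.
apply: le_trans (bounded_by_generator (@local_on_iter_generator _ k _ fm) ih eta) _.
rewrite !mulrA ler_wpM2r// factS exprS.
have -> : (8 * 8 ^+ k * (k.+1 * k`!)%:R * 'C(m + k.+1, k.+1)%:R : R) =
    8 ^+ k * k`!%:R * 8 * (k.+1 * 'C(m + k.+1, k.+1))%:R by rewrite !natrM; ring.
rewrite addnS -mul_bin_diag natrM.
have -> : 4 * (m + 2 * k).+1%:R * 8 ^+ k * k`!%:R * 'C(m + k, k)%:R =
    8 ^+ k * k`!%:R * (4 * (m + 2 * k).+1%:R) * 'C(m + k, k)%:R :> R by ring.
rewrite [leRHS]mulrA ler_wpM2r// -[leRHS]mulrA ler_wpM2l ?mulr_ge0 ?exprn_ge0//.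
by rewrite -!natrM ler_nat; lia.
Qed.

(** The factorials cancel, the binomial coefficient is at most [2^(m + K)], and [8 s <= 1/4] leaves
    the ratio 1/2. *)
Lemma taylor_near m K f C s : local_on m f -> bounded_by C f ->
  0 <= s -> s <= 32^-1 ->
  bounded_by (2 ^+ m / 2 ^+ K * C) (fun eta => S s f eta - taylor K s f eta).
Proof.
move=> fm fC s0 s32 eta; have C0 : 0 <= C by apply: le_trans (fC (fun=> false)).
apply: le_trans (@taylor_remainder K _ _ _ fm (@bounded_by_iter_generator _ K _ _ fm fC) _ s0 eta) _.
have -> : 8 ^+ K * K`!%:R * 'C(m + K, K)%:R * C * (s ^+ K / K`!%:R) =
    (8 * s) ^+ K * 'C(m + K, K)%:R * C.
  by rewrite exprMn; field; rewrite pnatr_eq0 -lt0n fact_gt0.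
rewrite ler_wpM2r//; apply: (@le_trans _ _ (4^-1 ^+ K * 2 ^+ (m + K))).
  apply: ler_pM => //; first by rewrite exprn_ge0// mulr_ge0.
    by rewrite lerXn2r ?nnegrE ?mulr_ge0//; lra.
  by rewrite -natrX ler_nat; exact: bin_leq_exp2.
rewrite exprD (_ : 4^-1 = 2^-1 * 2^-1); last by field.
have : (2 : R) ^+ K != 0 by rewrite expf_neq0// pnatr_eq0.
rewrite exprMn exprVn; set x := 2 ^+ K => x0.
by rewrite le_eqVlt (_ : _ * _ = 2 ^+ m / x) ?eqxx//; field.
Qed.

Lemma local_on_taylor m K s f : local_on m f -> local_on (m + 2 * K) (taylor K s f).
Proof.
move=> fm; apply: local_on_sum => k _; apply: local_onM; first exact: local_on_cst.
by apply: local_on_leq (@local_on_iter_generator _ k _ fm); have := ltn_ord k; lia.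
Qed.
End Semigroup.

Arguments continuous_comb {R} a {f g}.
Arguments continuous_const {R} c.

(** * Uniform closures of the local functions *)

Section UniformClosure.
Variable R : realType.
Implicit Types (f g u v : Omega -> R) (eta xi : Omega).

(** This stands in for continuity: it gives boundedness and measurability directly, without appeal
    to compactness. *)
Definition uapprox u : Prop := forall e : R, 0 < e ->
  exists m, exists2 g, local_on m g & bounded_by e (fun eta => u eta - g eta).

(* The pair (u, v) lies in the closure of the graph of the generator on local
   functions. *)
Definition in_closure u v : Prop := forall e : R, 0 < e ->
  exists m, exists g, [/\ local_on m g, bounded_by e (fun eta => u eta - g eta) &
    bounded_by e (fun eta => v eta - generator g eta)].

(** Approximation with an error exponentially small in the radius. This rate is what makes the
    spatial covariances summable. *)
Definition quasilocal u : Prop := exists A : R, exists d, forall m,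
  exists2 g, local_on (d * m) g &
    bounded_by (A / 2 ^+ m) (fun eta => u eta - g eta).

Lemma exists_pow2_le (C e : R) : 0 < e -> exists k, C / 2 ^+ k <= e.
Proof.
move=> e0; exists (Num.bound (C / e)).
have [C0|C0] := leP C 0.
  by apply: le_trans (ltW e0); rewrite pmulr_lle0// invr_gt0 exprn_gt0.
rewrite ler_pdivrMr ?exprn_gt0// mulrC -ler_pdivrMr//.
have := archi_boundP (divr_ge0 (ltW C0) (ltW e0)).
move=> /ltW h; apply: le_trans h _; rewrite -natrX ler_nat ltnW//.
exact: ltn_expl.
Qed.

Lemma uapprox_continuous u : uapprox u -> continuous u.
Proof.
move=> ua eta; apply/cvgrPdist_le => e e0.
have e20 : 0 < e / 2 by rewrite divr_gt0.
have e30 : 0 < e / 2 / 2 by rewrite divr_gt0.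
have [m [g gm ug]] := ua _ e30.
have := @local_on_continuous _ _ _ gm eta => /cvgrPdist_le /(_ _ e20).
apply: filterS => xi h; have := ug eta; have := ug xi => h1 h2.
have -> : u eta - u xi = (u eta - g eta) + (g eta - g xi) - (u xi - g xi) by ring.
have := ler_normB (u eta - g eta + (g eta - g xi)) (u xi - g xi).
by have := ler_normD (u eta - g eta) (g eta - g xi); lra.
Qed.

Lemma uapprox_tame u : uapprox u -> tame u.
Proof.
move=> ua; apply: tame_uniform_limit => e e0; have [m [g gm ug]] := ua _ e0.
by exists g => //; exact: tame_local gm.
Qed.

Lemma uapprox_bounded u : uapprox u -> exists2 M, 0 <= M & bounded_by M u.
Proof.
move=> /uapprox_tame[_ [M uM]]; exists M => //.
by apply: le_trans (uM (fun=> false)).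
Qed.

Lemma uapprox_local m f : local_on m f -> uapprox f.
Proof. by move=> fm e e0; exists m; exists f => // eta; rewrite subrr normr0 ltW. Qed.

Lemma uapproxD u v : uapprox u -> uapprox v -> uapprox (fun eta => u eta + v eta).
Proof.
move=> ua va e e0; have e20 : 0 < e / 2 by rewrite divr_gt0.
have [m [f fm uf]] := ua _ e20; have [n [g gn vg]] := va _ e20.
exists (maxn m n); exists (fun eta => f eta + g eta).
  by apply: local_onD; [apply: local_on_leq fm|apply: local_on_leq gn]; lia.
move=> eta; have -> : u eta + v eta - (f eta + g eta) =
    (u eta - f eta) + (v eta - g eta) by ring.
by apply: le_trans (ler_normD _ _) _; rewrite (splitr e) lerD.
Qed.

Lemma uapproxM u v : uapprox u -> uapprox v -> uapprox (fun eta => u eta * v eta).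
Proof.
move=> ua va e e0; have [M M0 uM] := uapprox_bounded ua.
have [N N0 vN] := uapprox_bounded va.
pose d := Num.min 1 (e / (M + N + 1)).
have d0 : 0 < d by rewrite lt_min ltr01 divr_gt0// ltr_wpDl// addr_ge0.
have [m [f fm uf]] := ua _ d0; have [n [g gn vg]] := va _ d0.
exists (maxn m n); exists (fun eta => f eta * g eta).
  by apply: local_onM; [apply: local_on_leq fm|apply: local_on_leq gn]; lia.
move=> eta; have -> : u eta * v eta - f eta * g eta =
  u eta * (v eta - g eta) + (u eta - f eta) * v eta
  - (u eta - f eta) * (v eta - g eta) by ring.
apply: le_trans (ler_normB _ _) _; apply: (@le_trans _ _ (M * d + d * N + d * 1)).
  apply: lerD; [apply: le_trans (ler_normD _ _) _; apply: lerD|];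
    rewrite normrM ler_pM// ?(uf eta)//.
  by apply: le_trans (vg eta) _; rewrite ge_min lexx.
have -> : M * d + d * N + d * 1 = d * (M + N + 1) by ring.
by rewrite -ler_pdivlMr ?ge_min ?lexx ?orbT// ltr_wpDl// addr_ge0.
Qed.

Lemma uapprox_sum (I : Type) (r : seq I) (F : I -> Omega -> R) :
  (forall i, uapprox (F i)) -> uapprox (fun eta => \sum_(i <- r) F i eta).
Proof.
move=> ua; elim: r => [|i r ih].
  by under eq_fun do rewrite big_nil; exact: (@uapprox_local 0).
by under eq_fun do rewrite big_cons; exact: uapproxD.
Qed.

Lemma in_closure_local m f : local_on m f -> in_closure f (generator f).
Proof.
by move=> fm e e0; exists m, f; split => // eta; rewrite subrr normr0 ltW.
Qed.

Lemma in_closure_uapprox u v : in_closure u v -> uapprox u /\ uapprox v.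
Proof.
move=> uv; split=> e e0; have [m [g [gm ug vg]]] := uv _ e0.
  by exists m; exists g.
by exists m.+2; exists (generator g) => //; exact: local_on_generator.
Qed.

Lemma in_closure_comb a u v u' v' : in_closure u v -> in_closure u' v' ->
  in_closure (fun eta => a * u eta + u' eta) (fun eta => a * v eta + v' eta).
Proof.
move=> uv uv' e e0; pose d := e / (`|a| + 1).
have d0 : 0 < d by rewrite divr_gt0// ltr_wpDl.
have [m [g [gm ug vg]]] := uv _ d0; have [m' [g' [gm' ug' vg']]] := uv' _ d0.
have gM : local_on (maxn m m') g by apply: local_on_leq gm; lia.
have gM' : local_on (maxn m m') g' by apply: local_on_leq gm'; lia.
have aux x y x' y' : `|x - y| <= d -> `|x' - y'| <= d ->
    `|a * x + x' - (a * y + y')| <= e.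
  move=> h h'; have -> : a * x + x' - (a * y + y') = a * (x - y) + (x' - y') by ring.
  apply: le_trans (ler_normD _ _) _; rewrite normrM.
  have -> : e = `|a| * d + d by rewrite /d; field; rewrite gt_eqF// ltr_wpDl.
  by rewrite lerD// ler_wpM2l.
exists (maxn m m'), (fun eta => a * g eta + g' eta); split.
- by apply: local_onD => //; apply: local_onM => //; exact: local_on_cst.
- by move=> eta; apply: aux; [exact: ug|exact: ug'].
- move=> eta; rewrite (generator_linear _ _ gM gM').
  by apply: aux; [exact: vg|exact: vg'].
Qed.

Lemma in_closure_sum (h : R) n (U V : 'I_n -> Omega -> R) :
  (forall i, in_closure (U i) (V i)) ->
  in_closure (fun eta => \sum_(i < n) h * U i eta) (fun eta => \sum_(i < n) h * V i eta).
Proof.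
elim: n U V => [|n ih] U V UV.
  have -> : (fun eta => \sum_(i < 0) h * U i eta) = fun=> 0.
    by apply/funext => eta; rewrite big_ord0.
  have -> : (fun eta => \sum_(i < 0) h * V i eta) = generator (fun=> 0).
    apply/funext => eta; rewrite big_ord0 (@generatorE _ 0 0)// big1// => i _.
    by rewrite /grad subrr mulr0.
  exact: (@in_closure_local 0).
have e W : (fun eta => \sum_(i < n.+1) h * W i eta) =
    fun eta => h * W ord0 eta + \sum_(i < n) h * W (lift ord0 i) eta.
  by apply/funext => eta; rewrite big_ord_recl.
by rewrite !e; apply: in_closure_comb => //; exact: ih.
Qed.

Lemma generator_sum m K (a : 'I_K -> R) (F : 'I_K -> Omega -> R) eta :
  (forall k, local_on m (F k)) ->
  generator (fun eta => \sum_(k < K) a k * F k eta) eta =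
  \sum_(k < K) a k * generator (F k) eta.
Proof.
move=> Fm; rewrite (@generatorE _ m m)//; last first.
  by apply: local_on_sum => k _; apply: local_onM => //; exact: local_on_cst.
under [RHS]eq_bigr do rewrite (generatorE _ (Fm _) (leqnn m)) mulr_sumr.
rewrite exchange_big/=; apply: eq_bigr => i _.
rewrite /grad -sumrB mulr_sumr; apply: eq_bigr => k _; ring.
Qed.

Lemma generator_taylor m K s f : local_on m f ->
  generator (taylor K s f) = taylor K s (generator f).
Proof.
move=> fm; apply/funext => eta; rewrite (@generator_sum (m + 2 * K)) => [|k].
  by apply: eq_bigr => k _; rewrite -iterSr.
by apply: local_on_leq (local_on_iter_generator fm); have := ltn_ord k; lia.
Qed.

Lemma generator_shift a f :
  generator (shift_fun a f) = shift_fun a (generator f).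
Proof.
apply/funext => eta; rewrite /shift_fun /generator; congr (_ * _).
rewrite [RHS](@reindex_fsbigT _ _ _ (int * int)%type (int * int)%type (fun xy : int * int => (xy.1 + a, xy.2 + a)))/=.
  apply: eq_fsbigr => -[x y] _ /=.
  have rE : rate R (x + a) (y + a) (shift_conf a eta) = rate R x y eta.
    rewrite /rate /occ /shift_conf.
    have e1 : (y + a == x + a + 1) = (y == x + 1) by apply/eqP/eqP; lia.
    have e2 : (x + a == y + a + 1) = (x == y + 1) by apply/eqP/eqP; lia.
    have e3 z : z + a - 1 - a = z - 1 by lia.
    have e4 z : z + a + 2 - a = z + 2 by lia.
    by rewrite e1 e2 !e3 !e4.
  have xE : exchange (x + a) (y + a) (shift_conf a eta) =
      shift_conf a (exchange x y eta).
    apply/funext => z; rewrite /shift_conf /exchange.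
    have e1 t : (z - a == t) = (z == t + a) by apply/eqP/eqP; lia.
    by rewrite !e1 !addrK.
  by rewrite rE xE.
apply: (@Bijective _ _ _ (fun xy : int * int => (xy.1 - a, xy.2 - a))).
  by move=> [x y] /=; rewrite !addrK.
by move=> [x y] /=; rewrite !subrK.
Qed.

Lemma local_on_shift m a f : local_on m f -> local_on (m + absz a) (shift_fun a f).
Proof.
by move=> fm eta xi h; apply: fm => y ym; rewrite /shift_conf; apply: h; lia.
Qed.

Lemma uapprox_shift a u : uapprox u -> uapprox (shift_fun a u).
Proof.
move=> ua e e0; have [m [g gm ug]] := ua _ e0.
exists (m + absz a)%N; exists (shift_fun a g); first exact: local_on_shift.
by move=> eta; exact: ug.
Qed.

Lemma taylor_shift K s a f : taylor K s (shift_fun a f) = shift_fun a (taylor K s f).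
Proof.
apply/funext => eta; rewrite /shift_fun /taylor; apply: eq_bigr => k _.
congr (_ * _); rewrite -[RHS]/(shift_fun a _ eta); congr (_ eta).
by elim: (k : nat) => //= n ->; rewrite generator_shift.
Qed.

End UniformClosure.

(** * Stability of the closures under the semigroup *)

Section Stability.
Variables (R : realType) (S : R -> (Omega -> R) -> Omega -> R).
Hypotheses (hS : markov_semigroup S) (hL : generated_by S (@generator R)).
Implicit Types (f g u v : Omega -> R) (eta xi : Omega).

(** The Taylor bounds hold for times up to 1/32; the semigroup property carries their consequences
    to all times in steps of that length. *)
Lemma small_step_induction (Q : R -> Prop) : Q 0 ->
  (forall s t, 0 <= s -> s <= 32^-1 -> 0 <= t -> Q t -> Q (s + t)) ->
  forall t, 0 <= t -> Q t.
Proof.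
move=> Q0 Qstep t t0.
suff main n : forall t, 0 <= t -> t <= n%:R / 32 -> Q t.
  apply: (main (Num.bound (t * 32))) => //.
  by rewrite ler_pdivlMr// ltW// archi_boundP// mulr_ge0.
elim: n => [|n ih] {}t {}t0 tn.
  by rewrite (_ : t = 0)//; apply/eqP; rewrite eq_le t0 andbT; move: tn; rewrite mul0r.
have [tl|tl] := leP t 32^-1; first by rewrite -(addr0 t); exact: Qstep.
have -> : t = 32^-1 + (t - 32^-1) by ring.
have tn' : t - 32^-1 <= n%:R / 32 by move: tn; rewrite -natr1 mulrDl mul1r; lra.
by apply: Qstep => //; [rewrite subr_ge0 ltW|apply: ih => //; rewrite subr_ge0 ltW].
Qed.

Lemma semigroup_local_approx m g C s e : local_on m g -> bounded_by C g ->
  0 <= s -> s <= 32^-1 -> 0 < e -> exists K0, forall K, (K0 <= K)%N ->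
  bounded_by e (fun eta => S s g eta - taylor K s g eta).
Proof.
move=> gm gC s0 s32 e0; have [k kP] := exists_pow2_le (2 ^+ m * C) e0.
exists k => K kK eta; apply: le_trans (taylor_near hS hL K gm gC s0 s32 eta) _.
apply: le_trans kP; rewrite mulrAC ler_wpM2l//.
  by rewrite mulr_ge0 ?exprn_ge0//; apply: le_trans (gC (fun=> false)).
by rewrite lef_pV2 ?posrE ?exprn_gt0// ler_weXn2l// ler1n.
Qed.

Lemma bounded_by_trans u v w (a b c : R) :
  bounded_by a (fun eta => u eta - v eta) ->
  bounded_by b (fun eta => v eta - w eta) -> a + b <= c ->
  bounded_by c (fun eta => u eta - w eta).
Proof.
move=> uv vw abc eta; apply: le_trans abc.
rewrite -(subrK (v eta) (u eta)) -addrA.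
by apply: le_trans (ler_normD _ _) _; apply: lerD; [exact: uv|exact: vw].
Qed.

(** Taylor sums commute with the generator: that of [g] approximates [S s] of the first component,
    and its generator, the Taylor sum of [generator g], approximates [S s] of the second. *)
Lemma in_closure_semigroup u v t : 0 <= t -> in_closure u v ->
  in_closure (S t u) (S t v).
Proof.
move=> t0 uv; move: t t0; apply: small_step_induction.
  have [/uapprox_continuous cu /uapprox_continuous cv] := in_closure_uapprox uv.
  by rewrite !(semigroup0 hS).
move=> s t s0 s32 t0 ih.
have [/uapprox_continuous cu /uapprox_continuous cv] := in_closure_uapprox uv.
have [/uapprox_continuous ctu /uapprox_continuous ctv] := in_closure_uapprox ih.
rewrite !(semigroupD hS)// => e e0; have e20 : 0 < e / 2 by rewrite divr_gt0.
have [m [g [gm ug vg]]] := ih _ e20.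
have Lgm := local_on_generator gm.
have [C _ gC] := local_bounded gm; have [C' _ LgC] := local_bounded Lgm.
have [K1 h1] := semigroup_local_approx gm gC s0 s32 e20.
have [K2 h2] := semigroup_local_approx Lgm LgC s0 s32 e20.
pose K := maxn K1 K2.
exists (m + 2 * K)%N, (taylor K s g); split; first exact: local_on_taylor.
- have near_g := semigroup_near hS s0 ctu (local_on_continuous gm) ug.
  by apply: bounded_by_trans near_g (h1 K (leq_maxl _ _)) _; lra.
- rewrite (generator_taylor _ _ gm).
  have near_Lg := semigroup_near hS s0 ctv (local_on_continuous Lgm) vg.
  by apply: bounded_by_trans near_Lg (h2 K (leq_maxr _ _)) _; lra.
Qed.

Lemma uapprox_semigroup u t : 0 <= t -> uapprox u -> uapprox (S t u).
Proof.
move=> t0 ua; move: t t0; apply: small_step_induction.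
  by rewrite (semigroup0 hS)//; exact: uapprox_continuous.
move=> s t s0 s32 t0 ih.
have cu := uapprox_continuous ua; have ctu := uapprox_continuous ih.
rewrite (semigroupD hS)// => e e0; have e20 : 0 < e / 2 by rewrite divr_gt0.
have [m [g gm ug]] := ih _ e20; have [C _ gC] := local_bounded gm.
have [K h] := semigroup_local_approx gm gC s0 s32 e20.
exists (m + 2 * K)%N; exists (taylor K s g); first exact: local_on_taylor.
have near_g := semigroup_near hS s0 ctu (local_on_continuous gm) ug.
by apply: bounded_by_trans near_g (h K (leqnn _)) _; lra.
Qed.

(** The generator commutes with translations, hence so do the Taylor sums, and the property passes
    to the limit. *)
Lemma semigroup_shift a u t : 0 <= t -> uapprox u ->
  S t (shift_fun a u) = shift_fun a (S t u).
Proof.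
move=> t0 ua; move: t t0; apply: small_step_induction.
  by rewrite !(semigroup0 hS)//; apply: uapprox_continuous => //; exact: uapprox_shift.
move=> s t s0 s32 t0 ih.
have ctu := uapprox_semigroup t0 ua.
have cu := uapprox_continuous ua; have cau := uapprox_continuous (uapprox_shift a ua).
rewrite !(semigroupD hS)// ih; move: (S t u) ctu => {ih cu cau u ua t t0} u ua.
apply/funext => eta; apply/eqP; rewrite -subr_eq0 -normr_le0; apply/ler_addgt0Pl => e e0.
rewrite addr0; have e40 : 0 < e / 4 by rewrite divr_gt0.
have [m [g gm ug]] := ua _ e40; have [C _ gC] := local_bounded gm.
have agm := @local_on_shift _ _ a _ gm.
have agC : bounded_by C (shift_fun a g) by move=> xi; exact: gC.
have [K1 h1] := semigroup_local_approx gm gC s0 s32 e40.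
have [K2 h2] := semigroup_local_approx agm agC s0 s32 e40.
pose K := maxn K1 K2.
have k1 := h1 K (leq_maxl _ _) (shift_conf a eta).
have k2 := h2 K (leq_maxr _ _) eta.
have cg := local_on_continuous gm; have cu := uapprox_continuous ua.
have k3 := semigroup_near hS s0 cu cg ug (shift_conf a eta).
have k4 : `|S s (shift_fun a u) eta - S s (shift_fun a g) eta| <= e / 4.
  apply: (semigroup_near hS s0) => [||xi].
  - by apply: uapprox_continuous; exact: uapprox_shift.
  - exact: local_on_continuous agm.
  - exact: ug.
rewrite taylor_shift in k2; move: k1 k2 k3 k4; rewrite /shift_fun.
rewrite !ler_norml => /andP[? ?] /andP[? ?] /andP[? ?] /andP[? ?].
by apply/andP; split; lra.
Qed.

Lemma quasilocal_uapprox u : quasilocal u -> uapprox u.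
Proof.
move=> [A [d uA]] e e0; have [k kP] := exists_pow2_le A e0.
have [g gm ug] := uA k; exists (d * k)%N; exists g => // eta.
exact: le_trans (ug eta) kP.
Qed.

Lemma quasilocal_local m f : local_on m f -> quasilocal f.
Proof.
move=> fm; have [C C0 fC] := local_bounded fm; exists C, m => -[|k].
  (* At exponent 0 the allowed radius is 0, so the approximant is the zero function and the constant
     must dominate [f] itself. *)
  exists (fun=> 0) => // eta; rewrite subr0 expr0 divr1; exact: fC.
exists f; first by apply: local_on_leq fm; rewrite leq_pmulr.
by move=> eta; rewrite subrr normr0 divr_ge0// exprn_ge0.
Qed.

(** In one short step an approximant of radius [d m] is replaced by its Taylor sum with
    [K = (d + 1) m] terms. The error factor [2^(d m - K)] is then [2^(-m)], and the radius stays
    linear in [m], with slope [d + 2 (d + 1)]. *)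
Lemma quasilocal_semigroup u t : 0 <= t -> quasilocal u -> quasilocal (S t u).
Proof.
move=> t0 uq; have ua := quasilocal_uapprox uq; move: t t0; apply: small_step_induction.
  by rewrite (semigroup0 hS)//; exact: uapprox_continuous.
move=> s t s0 s32 t0 ih.
have cu := uapprox_continuous ua.
rewrite (semigroupD hS)//; move: (S t u) ih => {cu u ua uq t t0} u uq.
have ua := quasilocal_uapprox uq; have cu := uapprox_continuous ua.
have [M M0 uM] := uapprox_bounded ua; have [A [d uA]] := uq.
have A0 : 0 <= A.
  have [g _ /(_ (fun=> false))] := uA 0; rewrite expr0 divr1; exact: le_trans.
exists (M + A + A), (d + 2 * d.+1)%N => m; have [g gm ug] := uA m.
have gC : bounded_by (M + A) g.
  move=> eta; rewrite -[g eta](subKr (u eta)).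
  apply: le_trans (ler_normB _ _) _; apply: lerD; first exact: uM.
  apply: le_trans (ug eta) _; rewrite ler_pdivrMr ?exprn_gt0// ler_peMr//.
  by rewrite exprn_ege1// ler1n.
pose K := (d.+1 * m)%N; exists (taylor K s g).
  by apply: local_on_leq (@local_on_taylor _ _ K s _ gm); rewrite /K; lia.
have near_g := semigroup_near hS s0 cu (local_on_continuous gm) ug.
apply: bounded_by_trans near_g (taylor_near hS hL K gm gC s0 s32) _.
have : (2 : R) ^+ m != 0 by rewrite expf_neq0.
have : (2 : R) ^+ (d * m) != 0 by rewrite expf_neq0.
rewrite /K mulSn exprD; set x := 2 ^+ (d * m); set y := 2 ^+ m => x0 y0.
by rewrite le_eqVlt (_ : _ + _ = (M + A + A) / y) ?eqxx//; field; rewrite y0.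
Qed.
End Stability.

(** * Symmetry of the Taylor sums *)

Section Reversibility.
Variables (R : realType) (S : R -> (Omega -> R) -> Omega -> R).
Hypotheses (hS : markov_semigroup S) (hL : generated_by S (@generator R)).
Variables (p : R) (mu : probability OmegaM R).
Hypothesis hmu : bernoulli_product p mu.
Implicit Types (f g u v : Omega -> R) (eta xi : Omega).

Local Notation E := (expect mu).

Lemma expect_mul_near f f' g g' (a b M N : R) : tame f -> tame f' -> tame g -> tame g' ->
  bounded_by M f -> bounded_by N g' ->
  bounded_by a (fun eta => f eta - f' eta) -> bounded_by b (fun eta => g eta - g' eta) ->
  `|E (fun eta => f eta * g eta) - E (fun eta => f' eta * g' eta)| <= M * b + a * N.
Proof.
move=> tf tf' tg tg' fM gN ff gg; rewrite -expectB; [|exact: tameM..].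
apply: expect_norm_le => [|eta]; first by apply: tameB; exact: tameM.
rewrite (_ : _ - _ = f eta * (g eta - g' eta) + (f eta - f' eta) * g' eta); last by ring.
apply: le_trans (ler_normD _ _) _; rewrite !normrM.
by apply: lerD; apply: ler_pM.
Qed.

Lemma taylor_symmetric K s m f g : local_on m f -> local_on m g ->
  E (fun eta => g eta * taylor K s f eta) = E (fun eta => taylor K s g eta * f eta).
Proof.
move=> fm gm.
have tk h k : local_on m h -> tame (iter k (@generator R) h).
  by move=> hm; exact: tame_local (@local_on_iter_generator _ _ k _ hm).
have sym k n h : local_on n h -> E (fun eta => h eta * iter k (@generator R) f eta) =
    E (fun eta => iter k (@generator R) h eta * f eta).
  elim: k n h => [//|k ih] n h hn; rewrite iterS iterSr.
  have hM : local_on (maxn n (m + 2 * k)) h by apply: local_on_leq hn; lia.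
  have fM : local_on (maxn n (m + 2 * k)) (iter k (@generator R) f).
    by apply: local_on_leq (@local_on_iter_generator _ _ k _ fm); lia.
  by rewrite (generator_symmetric hmu fM hM) (ih n.+2)//; exact: local_on_generator.
have tf := tame_local fm; have tg := tame_local gm.
have tkf k := tk f k fm; have tkg k := tk g k gm.
under eq_expect do rewrite /taylor mulr_sumr.
under [RHS]eq_expect do rewrite /taylor mulr_suml.
rewrite !expect_sum; last 2 first.
- by move=> k; apply: tameM => //; exact: tameZ.
- by move=> k; apply: tameM => //; exact: tameZ.
apply: eq_bigr => k _.
under eq_expect do rewrite mulrCA.
under [RHS]eq_expect do rewrite -mulrA.
by rewrite !expectZ ?(sym _ _ _ gm)//; exact: tameM.
Qed.

End Reversibility.

(** * Correlations of the current *)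

Section Correlations.
Variables (R : realType) (S : R -> (Omega -> R) -> Omega -> R).
Hypotheses (hS : markov_semigroup S) (hL : generated_by S (@generator R)).
Variables (p : R) (mu : probability OmegaM R).
Hypothesis hmu : bernoulli_product p mu.
Implicit Types (f g u v : Omega -> R) (eta xi : Omega).

Local Notation E := (expect mu).

(** Over one short step both sides are approximated by Taylor sums, which are symmetric. The
    functions stay quantified in the induction because part of the time is moved from one to the
    other. *)
Lemma semigroup_symmetric f g t : 0 <= t -> uapprox f -> uapprox g ->
  E (fun eta => g eta * S t f eta) = E (fun eta => S t g eta * f eta).
Proof.
move=> t0; move: t t0 f g; apply: small_step_induction => [f g fa ga|].
  by rewrite !(semigroup0 hS)//; exact: uapprox_continuous.
move=> s t s0 s32 t0 ih f g fa ga.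
have cf := uapprox_continuous fa; have cg := uapprox_continuous ga.
rewrite (semigroupD hS)// addrC (semigroupD hS)//.
have sga := uapprox_semigroup hS hL s0 ga; rewrite -ih//.
have := uapprox_semigroup hS hL t0 fa; move: (S t f) => {cf ih fa sga t t0} {}f fa.
have cf := uapprox_continuous fa.
apply/eqP; rewrite -subr_eq0 -normr_le0; apply/ler_addgt0Pl => e e0; rewrite addr0.
have [M M0 fM] := uapprox_bounded fa; have [N N0 gN] := uapprox_bounded ga.
(* The replacements [e1] and [e2] below cost [N (2 d) + d (M + 2)] and [N d + 2 d (M + 1)], in total
   [d (3 N + 3 M + 4)]. *)
pose d := Num.min 1 (e / (3 * N + 3 * M + 4)).
have c0 : 0 < 3 * N + 3 * M + 4 by lra.
have d0 : 0 < d by rewrite lt_min ltr01 divr_gt0.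
have d1 : d <= 1 by rewrite ge_min lexx.
have de : d * (3 * N + 3 * M + 4) <= e by rewrite -ler_pdivlMr// ge_min lexx orbT.
have [m [f' fm' ff]] := fa _ d0; have [n [g' gn' gg]] := ga _ d0.
have fm : local_on (maxn m n) f' by apply: local_on_leq fm'; lia.
have gm : local_on (maxn m n) g' by apply: local_on_leq gn'; lia.
have [C _ fC] := local_bounded fm; have [C' _ gC] := local_bounded gm.
have [K1 h1] := semigroup_local_approx hS hL fm fC s0 s32 d0.
have [K2 h2] := semigroup_local_approx hS hL gm gC s0 s32 d0.
pose K := maxn K1 K2.
have nf : bounded_by (2 * d) (fun eta => S s f eta - taylor K s f' eta).
  have := semigroup_near hS s0 cf (local_on_continuous fm) ff.
  by move=> h; apply: bounded_by_trans h (h1 K (leq_maxl _ _)) _; lra.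
have ng : bounded_by (2 * d) (fun eta => S s g eta - taylor K s g' eta).
  have := semigroup_near hS s0 cg (local_on_continuous gm) gg.
  by move=> h; apply: bounded_by_trans h (h2 K (leq_maxr _ _)) _; lra.
have bTf : bounded_by (M + 2) (taylor K s f').
  move=> eta; have := nf eta; have := semigroup_contract hS s0 cf fM eta.
  by rewrite !ler_norml => /andP[? ?] /andP[? ?]; apply/andP; split; lra.
have bf : bounded_by (M + 1) f'.
  move=> eta; have := ff eta; have := fM eta.
  by rewrite !ler_norml => /andP[? ?] /andP[? ?]; apply/andP; split; lra.
have bSg : bounded_by N (S s g) by exact: semigroup_contract.
have tf := uapprox_tame fa; have tg := uapprox_tame ga.
have tSf := uapprox_tame (uapprox_semigroup hS hL s0 fa).
have tSg := uapprox_tame (uapprox_semigroup hS hL s0 ga).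
have tf' := tame_local fm; have tg' := tame_local gm.
have tTf := tame_local (@local_on_taylor _ _ K s _ fm).
have tTg := tame_local (@local_on_taylor _ _ K s _ gm).
have e1 := expect_mul_near mu tg tg' tSf tTf gN bTf gg nf.
have e2 := expect_mul_near mu tSg tTg tf tf' bSg bf ng ff.
rewrite (taylor_symmetric hmu K s fm gm) in e1.
move: e1 e2; rewrite !ler_norml => /andP[? ?] /andP[? ?].
by apply/andP; split; lra.
Qed.

(** Symmetry against the constant 1, which the semigroup preserves. *)
Lemma semigroup_invariant u t : 0 <= t -> uapprox u -> E (S t u) = E u.
Proof.
move=> t0 ua; have u1 : uapprox (fun _ : Omega => 1 : R) by exact: (@uapprox_local _ 0).
have := semigroup_symmetric t0 ua u1; under eq_expect do rewrite mul1r.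
rewrite /= => ->; apply: eq_expect => eta.
by rewrite (semigroup1 hS t0) mul1r.
Qed.

(* Jensen: apply the positive operator S t to (u - S t u eta)^2. *)
Lemma semigroup_sqr_le u t eta : 0 <= t -> uapprox u ->
  S t u eta * S t u eta <= S t (fun eta => u eta * u eta) eta.
Proof.
move=> t0 ua; set c := S t u eta.
have cu := uapprox_continuous ua; have cuu := uapprox_continuous (uapproxM ua ua).
suff : 0 <= S t (fun eta => - 2 * c * u eta + (1 * (u eta * u eta) + c * c)) eta.
  rewrite (semigroup_comb hS _ _ t0 cu); last first.
    by apply: (continuous_comb 1 cuu); exact: continuous_const.
  rewrite (semigroup_comb hS _ _ t0 cuu (continuous_const _)).
  by rewrite (semigroup_cst hS)// -/c; lra.
apply: (semigroup_ge0 hS) => // [|xi].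
  by apply: (continuous_comb _ cu); apply: (continuous_comb 1 cuu); exact: continuous_const.
have -> : - 2 * c * u xi + (1 * (u xi * u xi) + c * c) = (u xi - c) ^+ 2 by ring.
exact: sqr_ge0.
Qed.

Lemma semigroup_contract_sqr u t : 0 <= t -> uapprox u ->
  E (fun eta => S t u eta * S t u eta) <= E (fun eta => u eta * u eta).
Proof.
move=> t0 ua; have uua := uapproxM ua ua; rewrite -(semigroup_invariant t0 uua).
have tSu := uapprox_tame (uapprox_semigroup hS hL t0 ua).
apply: le_expect => [||eta]; first exact: tameM.
  exact: uapprox_tame (uapprox_semigroup hS hL t0 uua).
exact: semigroup_sqr_le.
Qed.

Definition autocorrelation u t : R := E (fun eta => u eta * S t u eta).

Lemma expect_semigroup_mul u s t : 0 <= s -> 0 <= t -> uapprox u ->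
  E (fun eta => S s u eta * S t u eta) = autocorrelation u (s + t).
Proof.
move=> s0 t0 ua; have cu := uapprox_continuous ua.
rewrite /autocorrelation (semigroupD hS)// [RHS]semigroup_symmetric//.
exact: uapprox_semigroup.
Qed.

(** By symmetry the value at [t] is the squared norm of [S (t / 2) u]. *)
Lemma autocorrelation_ge0 u t : 0 <= t -> uapprox u -> 0 <= autocorrelation u t.
Proof.
move=> t0 ua; have t20 : 0 <= t / 2 by rewrite divr_ge0.
rewrite (splitr t) -expect_semigroup_mul//.
by apply: expect_ge0 => eta; rewrite -expr2 sqr_ge0.
Qed.

(** Passing from [s] to [t] applies the contraction [S ((t - s) / 2)] inside the squared norm of
    [S (s / 2) u]. *)
Lemma autocorrelation_nonincreasing u s t : 0 <= s -> s <= t -> uapprox u ->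
  autocorrelation u t <= autocorrelation u s.
Proof.
move=> s0 st ua; have cu := uapprox_continuous ua.
have s20 : 0 <= s / 2 by rewrite divr_ge0.
have d0 : 0 <= (t - s) / 2 by rewrite divr_ge0// subr_ge0.
rewrite (splitr s) -expect_semigroup_mul//.
have -> : t = ((t - s) / 2 + s / 2) + ((t - s) / 2 + s / 2) by field.
rewrite -expect_semigroup_mul//; [|exact: addr_ge0..].
rewrite (semigroupD hS)//.
by apply: semigroup_contract_sqr => //; exact: uapprox_semigroup.
Qed.

Lemma semigroup_sum n (F : 'I_n -> Omega -> R) t : 0 <= t ->
  (forall k, uapprox (F k)) ->
  S t (fun eta => \sum_(k < n) F k eta) = fun eta => \sum_(k < n) S t (F k) eta.
Proof.
move=> t0; elim: n F => [|n ih] F Fa.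
  have e (G : 'I_0 -> Omega -> R) : (fun eta => \sum_(k < 0) G k eta) = fun=> 0.
    by apply/funext => eta; rewrite big_ord0.
  by rewrite !e; apply/funext => eta; rewrite (semigroup_cst hS).
have e (G : 'I_n.+1 -> Omega -> R) : (fun eta => \sum_(k < n.+1) G k eta) =
    fun eta => 1 * G ord0 eta + \sum_(k < n) G (lift ord0 k) eta.
  by apply/funext => eta; rewrite big_ord_recl mul1r.
rewrite !e; apply/funext => eta; rewrite (semigroup_comb hS _ _ t0).
- by rewrite ih// => k; exact: Fa.
- exact: uapprox_continuous.
- by apply: uapprox_continuous; apply: uapprox_sum => k; exact: Fa.
Qed.

Lemma shift_funD x y u : shift_fun x (shift_fun y u) = shift_fun (x + y) u.
Proof.
apply/funext => eta; rewrite /shift_fun; congr u; apply/funext => z.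
by rewrite /shift_conf; congr eta; lia.
Qed.

Lemma expect_shift_mul x y u v : tame u -> tame v ->
  E (fun eta => shift_fun x u eta * shift_fun y v eta) =
  E (fun eta => shift_fun (x - y) u eta * v eta).
Proof.
move=> tu tv; rewrite -[RHS](expect_shift hmu y); last first.
  by apply: tameM => //; exact: tame_shift.
apply: eq_expect => eta; rewrite [in RHS]/shift_fun /=.
rewrite -[u (shift_conf (x - y) _)]/(shift_fun (x - y) u _).
rewrite -[shift_fun (x - y) u _]/(shift_fun y (shift_fun (x - y) u) eta).
by rewrite shift_funD addrC subrK.
Qed.

Lemma local_on_current : local_on 2 (current R).
Proof.
move=> eta xi h; rewrite !currentE /bond_current /bond_rate /bond_diff /occ.
by rewrite !h.
Qed.

Lemma uapprox_total_current n : uapprox (total_current (R := R) n).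
Proof.
by apply: uapprox_sum => k; apply: uapprox_shift; exact: uapprox_local local_on_current.
Qed.

Definition current_covariance t (z : int) : R :=
  E (fun eta => shift_fun z (current R) eta * S t (current R) eta).

Definition symmetric_sum (b : int -> R) (k : nat) : R :=
  b 0 + \sum_(i < k) (b i.+1%:Z + b (- i.+1%:Z)).

(** Enlarging the square by its last row and column adds each difference from [-n] to [n] exactly
    once. The second moment of a block thus becomes a sum of symmetric partial sums. *)
Lemma sum_differences (b : int -> R) n :
  \sum_(x < n) \sum_(y < n) b (x%:Z - y%:Z) = \sum_(k < n) symmetric_sum b k.
Proof.
elim: n => [|n ih]; first by rewrite !big_ord0.
rewrite [RHS]big_ord_recr [LHS]big_ord_recr/=.
under eq_bigr do rewrite big_ord_recr/=.
rewrite big_split/= ih -addrA; congr (_ + _).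
rewrite big_ord_recr/= subrr /symmetric_sum big_split/=.
have e1 : \sum_(x < n) b (x%:Z - n%:Z) = \sum_(i < n) b (- i.+1%:Z).
  rewrite -(big_mkord xpredT (fun x => b (x%:Z - n%:Z))).
  rewrite -(big_mkord xpredT (fun i => b (- i.+1%:Z))).
  rewrite big_nat_rev/= add0n; apply: eq_big_nat => i /andP[_ ni].
  by congr b; lia.
have e2 : \sum_(y < n) b (n%:Z - y%:Z) = \sum_(i < n) b i.+1%:Z.
  rewrite -(big_mkord xpredT (fun y => b (n%:Z - y%:Z))).
  rewrite -(big_mkord xpredT (fun i => b i.+1%:Z)).
  rewrite big_nat_rev/= add0n; apply: eq_big_nat => i /andP[_ ni].
  by congr b; lia.
by rewrite e1 e2; ring.
Qed.

Lemma autocorrelation_total_current n t : 0 <= t ->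
  autocorrelation (total_current n) t =
  \sum_(k < n) symmetric_sum (current_covariance t) k.
Proof.
move=> t0; rewrite -sum_differences /autocorrelation.
have ja := uapprox_local local_on_current.
have tj := uapprox_tame ja.
have tSj := uapprox_tame (uapprox_semigroup hS hL t0 ja).
rewrite /total_current semigroup_sum => [|//|k]; last exact: uapprox_shift.
under eq_expect do rewrite mulr_suml.
rewrite expect_sum => [|x]; last first.
  apply: tameM; first exact: tame_shift.
  apply: tame_sum => y; rewrite (semigroup_shift hS hL)//; exact: tame_shift.
apply: eq_bigr => x _; under eq_expect do rewrite mulr_sumr.
rewrite expect_sum => [|y]; last first.
  apply: tameM; first exact: tame_shift.
  by rewrite (semigroup_shift hS hL)//; exact: tame_shift.
apply: eq_bigr => y _; rewrite (semigroup_shift hS hL)//.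
exact: expect_shift_mul.
Qed.
End Correlations.

(** * Summability of the spatial covariances *)

Section Summability.
Variables (R : realType) (S : R -> (Omega -> R) -> Omega -> R).
Hypotheses (hS : markov_semigroup S) (hL : generated_by S (@generator R)).
Variables (p : R) (mu : probability OmegaM R).
Hypothesis hmu : bernoulli_product p mu.
Implicit Types (f g u v : Omega -> R) (eta xi : Omega).

Local Notation E := (expect mu).

Lemma bond_current_swap x eta : bond_current x (swap x eta) = - bond_current x eta :> R.
Proof.
rewrite /bond_current bond_rate_swap /bond_diff /occ !swapE !eqxx.
have -> : (x + 1 == x) = false by apply/eqP; lia.
by ring.
Qed.

Lemma tame_bond_current x : tame (bond_current x : Omega -> R).
Proof. by apply: tameM; [exact: tame_bond_rate|exact: tame_bond_diff]. Qed.

(** The bond current is odd under the exchange on its own bond, to which [g] is insensitive. *)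
Lemma expect_bond_current_eq0 m x g : local_on m g ->
  (m < absz x)%N -> (m < absz (x + 1)%R)%N ->
  E (fun eta => bond_current x eta * g eta) = 0.
Proof.
move=> gm h1 h2; rewrite (expect_odd_mul hmu (x := x)).
- rewrite (eq_expect mu (g := fun=> 0)) ?expect_cst ?mulr0// => eta.
  by rewrite (grad_eq0 _ gm)// mulr0.
- exact: tame_bond_current.
- exact: tame_local gm.
- by move=> eta; exact: bond_current_swap.
Qed.

(** The translate consists of the currents on the bonds starting at [-z] and [-z - 1]; the extra
    unit in the hypothesis keeps the sites [-z - 1] to [-z + 1] outside [[-m, m]]. *)
Lemma expect_shift_current_eq0 m z g : local_on m g -> (m.+1 < absz z)%N ->
  E (fun eta => shift_fun z (current R) eta * g eta) = 0.
Proof.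
move=> gm zm; have tg := tame_local gm.
under eq_expect do rewrite shift_current -mulrA mulrDl.
have h1 := tame_bond_current (- z); have h2 := tame_bond_current (- z - 1).
rewrite expectZ ?expectD; [|exact: tameM..|by apply: tameD; exact: tameM].
by rewrite !(expect_bond_current_eq0 gm) ?addr0 ?mulr0//; lia.
Qed.

Lemma shift_current_bounded z : bounded_by 1 (shift_fun z (current R)).
Proof.
move=> eta; rewrite shift_current.
have := bond_current_bounded R (- z) eta; have := bond_current_bounded R (- z - 1) eta.
by rewrite !ler_norml => /andP[? ?] /andP[? ?]; apply/andP; split; lra.
Qed.

(** Far from the origin the covariance with the local approximant vanishes, so only the
    approximation error is left. *)
Lemma covariance_decay u : quasilocal u -> exists A D, [/\ 0 <= A, (0 < D)%N &
  forall m z, (D * m < (absz z).-1)%N ->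
  `|E (fun eta => shift_fun z (current R) eta * u eta)| <= A / 2 ^+ m].
Proof.
move=> uq; have tu := uapprox_tame (quasilocal_uapprox uq).
have [A [d uA]] := uq; exists A, d.+1; split => //.
  by have [g _ /(_ (fun=> false))] := uA 0; rewrite expr0 divr1; exact: le_trans.
move=> m z zm; have [g gm ug] := uA m; have tg := tame_local gm.
have tj : tame (shift_fun z (current R)).
  by apply: tame_shift; exact: tame_local (@local_on_current R).
rewrite -[X in `|X|]subr0 -(@expect_shift_current_eq0 _ z _ gm); last by lia.
rewrite -expectB; [|exact: tameM..].
apply: expect_norm_le => [|eta]; first by apply: tameB; exact: tameM.
rewrite -mulrBr normrM -[leRHS]mul1r; apply: ler_pM => //.
exact: shift_current_bounded.
Qed.

(** The positive indices are cut into blocks of length [D]. The block following [D * M] contributes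
    at most [D A / 2^M], and these bounds form a geometric series. *)
Lemma block_sum_bounded (c : nat -> R) A D : (0 < D)%N -> 0 <= A ->
  (forall i, 0 <= c i) -> (forall m i, (D * m < i)%N -> c i <= A / 2 ^+ m) ->
  forall k, \sum_(i < k) c i <= c 0 + 2 * A * D%:R.
Proof.
move=> D0 A0 c0 cA.
have block M : \sum_(0 <= i < (D * M).+1) c i <= c 0 + 2 * A * D%:R * (1 - (2 ^+ M)^-1).
  elim: M => [|M ih]; first by rewrite muln0 big_nat1 expr0 invr1 subrr mulr0 addr0.
  rewrite (@big_cat_nat _ _ _ (D * M).+1)//=; last by rewrite ltnS leq_mul2l leqnSn orbT.
  have : \sum_((D * M).+1 <= i < (D * M.+1).+1) c i <= D%:R * (A / 2 ^+ M).
    apply: (@le_trans _ _ (\sum_((D * M).+1 <= i < (D * M.+1).+1) A / 2 ^+ M)).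
      by apply: ler_sum_nat => i /andP[h _]; exact: cA.
    rewrite sumr_const_nat (_ : ((D * M.+1).+1 - (D * M).+1)%N = D); last by lia.
    by rewrite mulr_natl.
  move=> h; apply: le_trans (lerD ih h) _; rewrite exprS.
  have : (2 : R) ^+ M != 0 by rewrite expf_neq0.
  set x := 2 ^+ M => x0; rewrite le_eqVlt; apply/orP; left; apply/eqP.
  by field.
move=> k; rewrite -(big_mkord xpredT c).
apply: (@le_trans _ _ (\sum_(0 <= i < (D * k).+1) c i)).
  rewrite [leRHS](@big_cat_nat _ _ _ k)//=; last by rewrite leqW// leq_pmull.
  by rewrite lerDl sumr_ge0.
by apply: le_trans (block k) _; rewrite lerD2l ler_piMr ?mulr_ge0//.
Qed.

Lemma covariance_summable u : quasilocal u -> exists B, forall k,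
  symmetric_sum (fun z =>
    `|E (fun eta => shift_fun z (current R) eta * u eta)|) k <= B.
Proof.
move=> /covariance_decay[A [D [A0 D0 decay]]].
set b := fun z => `|_|; pose c i := b i.+1%:Z + b (- i.+1%:Z).
exists (b 0 + (c 0 + 2 * (2 * A) * D%:R)) => k; rewrite lerD2l.
apply: (block_sum_bounded (c := c)) => //; first exact: mulr_ge0.
  by move=> i; apply: addr_ge0; exact: normr_ge0.
by move=> m i mi; rewrite -mulrA mulr_natl mulr2n lerD//; apply: decay; lia.
Qed.

End Summability.

(** * Sums over the integers as limits of symmetric partial sums *)

Section SumZ.
Variable R : realType.
Implicit Types (u v : int -> R).

Definition symmetric_range (k : nat) : seq int :=
  0 :: [seq i.+1%:Z | i <- iota 0 k] ++ [seq - i.+1%:Z | i <- iota 0 k].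

Lemma symmetric_rangeP k x : (x \in symmetric_range k) = (absz x <= k)%N.
Proof.
apply/idP/idP.
  rewrite in_cons mem_cat => /orP[/eqP->//|/orP[]] /mapP[i];
  by rewrite mem_iota => ik ->; lia.
move=> xk; rewrite in_cons mem_cat; case: (ltrgt0P x) => x0 //=; apply/orP.
  by left; apply/mapP; exists (absz x).-1; [rewrite mem_iota; lia|lia].
by right; apply/mapP; exists (absz x).-1; [rewrite mem_iota; lia|lia].
Qed.

Lemma symmetric_range_uniq k : uniq (symmetric_range k).
Proof.
have i1 : injective (fun i : nat => i.+1%:Z) by move=> i j; lia.
have i2 : injective (fun i : nat => - i.+1%:Z) by move=> i j; lia.
rewrite /symmetric_range cons_uniq cat_uniq (map_inj_uniq i1) (map_inj_uniq i2).
rewrite iota_uniq /= andbT; apply/andP; split.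
  by rewrite mem_cat; apply/negP => /orP[] /mapP[i _]; lia.
by apply/hasPn => _ /mapP[i _ ->]; apply/negP => /mapP[j _]; lia.
Qed.

Lemma symmetric_sumE v k : symmetric_sum v k = \sum_(x <- symmetric_range k) v x.
Proof.
rewrite /symmetric_range big_cons big_cat !big_map /symmetric_sum big_split/=.
rewrite -(big_mkord xpredT (fun i => v i.+1%:Z)).
by rewrite -(big_mkord xpredT (fun i => v (- i.+1%:Z))) /index_iota subn0.
Qed.

(** Every finite set of integers lies in a symmetric range, so the supremum over finite sets is the
    limit of the monotone symmetric sums. *)
Lemma esum_symmetric_sum v B : (forall x, 0 <= v x) ->
  (forall k, symmetric_sum v k <= B) -> exists2 l,
  (\esum_(x in [set: int]) (v x)%:E)%E = l%:E &
  symmetric_sum v k @[k --> \oo] --> l.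
Proof.
move=> v0 vB.
have nd : nondecreasing_seq (symmetric_sum v).
  apply/nondecreasing_seqP => k; rewrite /symmetric_sum lerD2l big_ord_recr/= lerDl.
  exact: addr_ge0.
have ub : has_ubound (range (symmetric_sum v)) by exists B => _ [k _ <-].
have cv := nondecreasing_cvgn nd ub; set l := sup _ in cv.
have ul k : symmetric_sum v k <= l by apply: sup_ubound => //; exists k.
have fE k : (symmetric_sum v k)%:E = (\sum_(x \in [set` symmetric_range k]) (v x)%:E)%E.
  by rewrite -fsbig_seq ?symmetric_range_uniq// sumEFin symmetric_sumE.
exists l => //; apply/eqP; rewrite eq_le; apply/andP; split.
  apply: ge_ereal_sup => _ [A [fA _] <-].
  pose k := (\max_(x <- finmap.enum_fset (fset_set A)) absz x)%N.
  apply: le_trans (_ : (symmetric_sum v k)%:E <= _)%E; last by rewrite lee_fin.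
  rewrite fE; apply: lee_fsum_nneg_subset => //; first exact: finite_seq.
    move=> x xA; rewrite inE/= symmetric_rangeP.
    apply: (@leq_bigmax_seq _ _ xpredT absz x) => //.
    by rewrite in_fset_set.
  by move=> x _; rewrite lee_fin.
have cvE : (symmetric_sum v k)%:E @[k --> \oo] --> l%:E.
  by apply: cvg_EFin; [exact: nearW|exact: cv].
rewrite -(cvg_lim _ cvE)//; apply: lime_le; first by apply/cvg_ex; exists l%:E.
apply: nearW => k; rewrite fE; apply: esum_ge.
by exists [set` symmetric_range k] => //; split; [exact: finite_seq|].
Qed.

(** The positive and negative parts are both dominated by the absolute value, so their sums are
    finite and the difference defining [sumZ] is a genuine one. *)
Lemma sumZ_symmetric_sum u B :
  (forall k, symmetric_sum (fun x => `|u x|) k <= B) -> exists2 l,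
  sumZ u = l%:E & symmetric_sum u k @[k --> \oo] --> l.
Proof.
move=> uB.
have le_sum (v w : int -> R) k : (forall x, v x <= w x) -> symmetric_sum v k <= symmetric_sum w k.
  by move=> vw; rewrite lerD// ler_sum// => i _; rewrite lerD.
have [||l1 e1 c1] := @esum_symmetric_sum (fun x => Num.max (u x) 0) B.
- by move=> x; rewrite le_max lexx orbT.
- move=> k; apply: le_trans (uB k); apply: le_sum => x.
  by rewrite ge_max normr_ge0 ler_norm.
have [||l2 e2 c2] := @esum_symmetric_sum (fun x => Num.max (- u x) 0) B.
- by move=> x; rewrite le_max lexx orbT.
- move=> k; apply: le_trans (uB k); apply: le_sum => x.
  by rewrite ge_max normr_ge0 -normrN ler_norm.
exists (l1 - l2); first by rewrite /sumZ e1 e2.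
rewrite (_ : (fun k => _) = fun k => symmetric_sum (fun x => Num.max (u x) 0) k
    - symmetric_sum (fun x => Num.max (- u x) 0) k); first exact: cvgB.
apply/funext => k.
have uE x : u x = Num.max (u x) 0 - Num.max (- u x) 0.
  by case: (lerP (u x) 0) => h; case: (lerP (- u x) 0) => h'; lra.
rewrite /symmetric_sum opprD addrACA -uE -sumrB; congr (_ + _).
by apply: eq_bigr => i _; rewrite opprD addrACA -!uE.
Qed.
End SumZ.

(** * Bounding the time integral *)

Section RiemannBound.
Variables (R : realType) (S : R -> (Omega -> R) -> Omega -> R).
Hypotheses (hS : markov_semigroup S) (hL : generated_by S (@generator R)).
Variables (p : R) (mu : probability OmegaM R).
Hypothesis hmu : bernoulli_product p mu.
Implicit Types (f g u v : Omega -> R) (eta xi : Omega).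

Local Notation E := (expect mu).
Local Notation static_bound lam d n := (n%:R * nongradient_energy p lam / 4 +
  (1 + 10 * `|lam|) ^+ 2 / (4 * d)).

(** All the pairings are continuous in the uniform norm, so the static bound extends from local
    functions to the closure of the generator. *)
Lemma total_current_closure_bound (lam d : R) n u v : in_closure u v -> 0 < d ->
  E (fun eta => total_current n eta * u eta) <=
  static_bound lam d n + d * E (fun eta => u eta * u eta)
  - 2^-1 * E (fun eta => u eta * v eta).
Proof.
move=> uv d0; have [ua va] := in_closure_uapprox uv.
have Ja := uapprox_total_current (R := R) n.
have [C C0 JC] := uapprox_bounded Ja; have [M M0 uM] := uapprox_bounded ua.
have [N N0 vN] := uapprox_bounded va.
have tJ := uapprox_tame Ja; have tu := uapprox_tame ua; have tv := uapprox_tame va.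
apply/ler_addgt0Pl => e e0.
(* Errors per unit of [r]: [C] from the pairing with the total current, [2 M + 1] from the squared
   norm, with weight [d], and [M + N + 1] from the Dirichlet form, with weight 1/2. *)
pose c := C + d * (2 * M + 1) + (M + N + 1) / 2.
have c0 : 0 < c + 1 by rewrite /c; have := mulr_ge0 (ltW d0) M0; lra.
pose r := Num.min 1 (e / (c + 1)).
have r0 : 0 < r by rewrite lt_min ltr01 divr_gt0.
have r1 : r <= 1 by rewrite ge_min lexx.
have re : r * (c + 1) <= e by rewrite -ler_pdivlMr// ge_min lexx orbT.
have [m [g [gm ug vg]]] := uv _ r0.
have tg := tame_local gm; have tLg := tame_local (local_on_generator gm).
have gM : bounded_by (M + 1) g.
  move=> eta; have := ug eta; have := uM eta.
  by rewrite !ler_norml => /andP[? ?] /andP[? ?]; apply/andP; split; lra.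
have LgN : bounded_by (N + 1) (generator g).
  move=> eta; have := vg eta; have := vN eta.
  by rewrite !ler_norml => /andP[? ?] /andP[? ?]; apply/andP; split; lra.
have JJ : bounded_by 0 (fun eta => total_current (R := R) n eta - total_current n eta).
  by move=> eta; rewrite subrr normr0.
have := total_current_static_bound hmu lam n gm d0.
have := expect_mul_near mu tJ tJ tu tg JC gM JJ ug.
have := expect_mul_near mu tu tg tu tg uM gM ug ug.
have := expect_mul_near mu tu tg tv tLg uM LgN ug vg.
have -> : E (fun eta => g eta ^+ 2) = E (fun eta => g eta * g eta).
  by apply: eq_expect => eta; rewrite expr2.
set W := E (fun eta => u eta * v eta); set W' := E (fun eta => g eta * generator g eta).
set Q := E (fun eta => u eta * u eta); set Q' := E (fun eta => g eta * g eta).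
set A := E (fun eta => total_current n eta * u eta).
set A' := E (fun eta => total_current n eta * g eta).
set sb := static_bound lam d n.
rewrite !ler_norml => /andP[w1 w2] /andP[q1 q2] /andP[a1 a2] s.
have dq : d * Q' <= d * (Q + r * (2 * M + 1)) by rewrite ler_pM2l//; lra.
have rc : r * c + r <= e by rewrite -[X in _ + X]mulr1 -mulrDr.
have : r * c = r * C + d * (r * (2 * M + 1)) + r * (M + N + 1) / 2 by rewrite /c; ring.
by move=> rcE; rewrite mulrDr in dq; lra.
Qed.

(* The test function is the Riemann sum u = h \sum_(i < M) S (i h) f with
   h = T / M, for which the sum of the S (i h) (L f) telescopes up to O(T w). *)
Lemma riemann_sum_bound (lam d T e : R) n : 0 < d -> 0 < T -> 0 < e ->
  exists2 M, (0 < M)%N &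
  (T / M%:R) * \sum_(i < M) autocorrelation S mu (total_current n) (i%:R * (T / M%:R)) <=
  n%:R * nongradient_energy p lam / 2 + (1 + 10 * `|lam|) ^+ 2 / (2 * d) +
  2 * d * T ^+ 2 * autocorrelation S mu (total_current n) 0 + e.
Proof.
move=> d0 T0 e0; set f : Omega -> R := total_current n.
have fa : uapprox f := uapprox_total_current (R := R) n.
have [m fm] : exists m, local_on m f.
  exists (2 + n)%N; apply: local_on_sum => k _.
  by apply: local_on_leq (@local_on_shift _ 2 k _ (@local_on_current R)); have := ltn_ord k; lia.
have cf := local_on_continuous fm; have Lfm := local_on_generator fm.
have cL := local_on_continuous Lfm.
have [C C0 fC] := local_bounded fm.
(* The vector [v] will be within [T w] of [S T f - f] and is paired with [u], bounded by [T C]: the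
   total error is [T^2 C w <= e]. *)
pose w := e / (T ^+ 2 * C + 1).
have w0 : 0 < w by rewrite divr_gt0// ltr_wpDl// mulr_ge0// exprn_ge0// ltW.
have wE : T ^+ 2 * C * w <= e.
  rewrite /w mulrA ler_pdivrMr; last by rewrite ltr_wpDl// mulr_ge0// exprn_ge0// ltW.
  by rewrite mulrC ler_pM2l// lerDl.
have [r r0 hr] := generator_near0 hL fm w0.
pose M := (Num.bound (T / r)).+1; exists M => //.
have M0 : 0 < M%:R :> R by rewrite ltr0n.
set h := T / M%:R; have h0 : 0 < h by rewrite divr_gt0.
have hM : h * M%:R = T by rewrite /h mulfVK// gt_eqF.
have hlr : h < r.
  rewrite /h ltr_pdivrMr// mulrC -ltr_pdivrMr//.
  have := archi_boundP (divr_ge0 (ltW T0) (ltW r0)) => /lt_trans; apply.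
  by rewrite ltr_nat.
have ih0 (i : nat) : 0 <= i%:R * h by rewrite mulr_ge0// ltW.
pose U (i : nat) := S (i%:R * h) f; pose V (i : nat) := S (i%:R * h) (generator f).
pose u eta := \sum_(i < M) h * U i eta; pose v eta := \sum_(i < M) h * V i eta.
have uv : in_closure u v.
  apply: in_closure_sum => i; apply: (in_closure_semigroup hS hL) => //.
  exact: in_closure_local fm.
have Ua i : uapprox (U i) by exact: (uapprox_semigroup hS hL).
have tU i := uapprox_tame (Ua i); have tf := uapprox_tame fa.
have [ua va] := in_closure_uapprox uv.
have tu := uapprox_tame ua; have tv := uapprox_tame va.
set a := autocorrelation S mu f.
have fu : E (fun eta => f eta * u eta) = h * \sum_(i < M) a (i%:R * h).
  under eq_expect do rewrite mulr_sumr.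
  rewrite expect_sum => [|i]; last by apply: tameM => //; exact: tameZ.
  rewrite mulr_sumr; apply: eq_bigr => i _; under eq_expect do rewrite mulrCA.
  by rewrite expectZ//; exact: tameM.
have uf t : 0 <= t ->
    E (fun eta => u eta * S t f eta) = \sum_(i < M) h * a (i%:R * h + t).
  move=> t0; have tSt := uapprox_tame (uapprox_semigroup hS hL t0 fa).
  under eq_expect do rewrite mulr_suml.
  rewrite expect_sum => [|i]; last by apply: tameM => //; exact: tameZ.
  apply: eq_bigr => i _; under eq_expect do rewrite -mulrA.
  by rewrite expectZ ?(expect_semigroup_mul hS hL hmu)//; exact: tameM.
have sumh (x : R) : \sum_(i < M) h * x = T * x.
  by rewrite sumr_const card_ord -mulr_natl mulrA -hM; ring.
(* The squared norm is a double Riemann sum of autocorrelations, each at most the one at time 0. *)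
have uu : E (fun eta => u eta * u eta) <= T ^+ 2 * a 0.
  have -> : E (fun eta => u eta * u eta) =
      \sum_(k < M) h * E (fun eta => u eta * U k eta).
    rewrite (@eq_expect _ mu _ (fun eta => \sum_(k < M) h * (u eta * U k eta))).
      rewrite expect_sum => [|k]; last by apply: tameZ; exact: tameM.
      by apply: eq_bigr => k _; rewrite expectZ//; exact: tameM.
    move=> eta; rewrite {2}/u mulr_sumr; apply: eq_bigr => k _; exact: mulrCA.
  rewrite expr2 -mulrA -sumh; apply: ler_sum => k _; rewrite ler_pM2l//.
  rewrite uf// -sumh; apply: ler_sum => i _; rewrite ler_pM2l//.
  by apply: (autocorrelation_nonincreasing hS hL hmu) => //; exact: addr_ge0.
(* The i-th term is [S (i h)] applied to [h L f - (S h f - f)], which is at most [h w] in size by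
   the choice of [h]. *)
have vST : bounded_by (T * w) (fun eta => v eta - (S T f eta - f eta)).
  move=> eta; have -> : S T f eta - f eta = \sum_(i < M) (U i.+1 eta - U i eta).
    rewrite -(big_mkord xpredT (fun i => U i.+1 eta - U i eta)) telescope_sumr//.
    by rewrite /U mul0r (semigroup0 hS)// mulrC hM.
  rewrite /v -sumrB; apply: le_trans (ler_norm_sum _ _ _) _.
  apply: (@le_trans _ _ (\sum_(i < M) h * w)); last by rewrite sumh.
  apply: ler_sum => i _; have ch := semigroup_continuous hS (ltW h0) cf.
  have := @semigroup_contract3 _ _ hS (i%:R * h) h (-1) 1 (generator f) (S h f) f (h * w)
    (ih0 i) cL ch cf.
  rewrite /U -natr1 mulrDl mul1r (semigroupD hS (ih0 i) (ltW h0) cf) /V => H.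
  rewrite (_ : _ - _ = h * S (i%:R * h) (generator f) eta +
    (-1 * S (i%:R * h) (S h f) eta + 1 * S (i%:R * h) f eta)); last by ring.
  apply: H => xi; have := hr _ h0 hlr xi.
  set x := S h f xi - f xi; set l := generator f xi => xl.
  have -> : h * l + (-1 * S h f xi + 1 * f xi) = - (h * (h^-1 * x - l)).
    by rewrite /x; field; rewrite gt_eqF.
  by rewrite normrN normrM gtr0_norm// ler_pM2l.
have uC : bounded_by (T * C) u.
  move=> eta; apply: le_trans (ler_norm_sum _ _ _) _; rewrite -sumh.
  apply: ler_sum => i _; rewrite normrM gtr0_norm// ler_pM2l//.
  exact: (semigroup_contract hS).
have uvE : - E (fun eta => u eta * v eta) <=
    E (fun eta => f eta * u eta) + T * C * (T * w).
  have tST := uapprox_tame (uapprox_semigroup hS hL (ltW T0) fa).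
  have -> : E (fun eta => f eta * u eta) = E (fun eta => u eta * f eta).
    by apply: eq_expect => eta; rewrite mulrC.
  have h1 := @expect_mul_near _ mu u u v (fun eta => S T f eta - f eta) 0 (T * w)
    (T * C) (C + C) tu tu tv (tameB tST tf) uC.
  have : `|E (fun eta => u eta * v eta) - E (fun eta => u eta * (S T f eta - f eta))|
      <= T * C * (T * w) + 0 * (C + C).
    apply: h1 => // eta; last by rewrite subrr normr0.
    apply: le_trans (ler_normB _ _) _; apply: lerD => //.
    exact: (semigroup_contract hS (ltW T0) cf fC).
  have -> : E (fun eta => u eta * (S T f eta - f eta)) =
      E (fun eta => u eta * S T f eta) - E (fun eta => u eta * f eta).
    rewrite -expectB; [|exact: tameM..].
    by apply: eq_expect => eta; rewrite mulrBr.
  have : 0 <= E (fun eta => u eta * S T f eta).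
    rewrite (uf _ (ltW T0)); apply: sumr_ge0 => i _; apply: mulr_ge0; first exact: ltW.
    by apply: (autocorrelation_ge0 hS hL hmu) => //; rewrite addr_ge0// ltW.
  by rewrite ler_norml => ? /andP[? ?]; lra.
(* Half of the pairing of [f] with [u] reappears on the right and is absorbed on the left, which
   doubles the other constants. *)
have := total_current_closure_bound lam n uv d0.
rewrite -/f -fu.
move: uu uvE wE; set X := E (fun eta => f eta * u eta).
set Y := E (fun eta => u eta * v eta); set Z := E (fun eta => u eta * u eta).
move=> uu uvE wE; have : d * Z <= d * (T ^+ 2 * a 0) by rewrite ler_pM2l.
have TCw : T * C * (T * w) = T ^+ 2 * C * w by ring.
rewrite TCw in uvE.
have -> : (1 + 10 * `|lam|) ^+ 2 / (2 * d) = 2 * ((1 + 10 * `|lam|) ^+ 2 / (4 * d)).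
  by field; rewrite gt_eqF.
by move: ((1 + 10 * `|lam|) ^+ 2 / (4 * d)) => b; lra.
Qed.
End RiemannBound.

(** * Integrals of nonincreasing functions *)

Section MonotoneIntegral.
Variable R : realType.
Implicit Types (F : R -> R).
Local Notation leb := (@lebesgue_measure R).

Lemma integral_le_riemann_sum F (h : R) M : nonincreasing_fun F ->
  (forall x, 0 <= F x) -> 0 < h ->
  (\int[leb]_(t in `[0%R, (M%:R * h)%R[) (F t)%:E <=
   (h * \sum_(i < M) F (i%:R * h))%:E)%E.
Proof.
move=> Fni F0 h0; have mF D : measurable D -> measurable_fun D (EFin \o F).
  by move=> mD; apply/measurable_EFinP; exact: nonincreasing_measurable.
elim: M => [|M ih].
  by rewrite mul0r set_itvco0 integral_set0 big_ord0 mulr0.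
have e : `[0, M.+1%:R * h[%classic = `[0, M%:R * h[%classic `|` `[M%:R * h, M.+1%:R * h[%classic.
  rewrite -itv_bndbnd_setU// bnd_simp; first by rewrite mulr_ge0// ltW.
  by rewrite ler_pM2r// ler_nat.
rewrite e ge0_integral_setU//=; last 3 first.
- by apply: mF; exact: measurableU.
- by move=> x _; rewrite lee_fin.
- apply/disj_setPS => x /=; rewrite !in_itv/= => -[/andP[_ a] /andP[b _]].
  by move: (lt_le_trans a b); rewrite ltxx.
rewrite big_ord_recr /= mulrDr EFinD; apply: leeD => //.
apply: (@le_trans _ _ (\int[leb]_(t in `[(M%:R * h)%R, (M.+1%:R * h)%R[) (cst (F (M%:R * h))%:E) t)%E).
  apply: ge0_le_integral => //.
  - by move=> x _; rewrite lee_fin.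
  - exact: mF.
  - by move=> x; rewrite /= in_itv/= => /andP[a _]; rewrite lee_fin; exact: Fni.
rewrite integral_cst//= lebesgue_measure_itv/= lte_fin ltr_pM2r// ltr_nat ltnSn.
by rewrite -EFinB -EFinM lee_fin -natr1 mulrDl mul1r addrAC subrr add0r mulrC.
Qed.

Lemma limn_einf_le (u : (\bar R)^nat) (v : R^nat) (l : R) :
  (forall n, (u n <= (v n)%:E)%E) -> v n @[n --> \oo] --> l -> (limn_einf u <= l%:E)%E.
Proof.
move=> uv vl; have vlE : (v n)%:E @[n --> \oo] --> l%:E.
  by apply: cvg_EFin; [exact: nearW|exact: vl].
rewrite limn_einf_lim -(cvg_lim _ vlE)//; apply: lee_lim.
- exact: is_cvg_einfs.
- by apply/cvg_ex; exists l%:E.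
apply: nearW => n; apply: le_trans (uv n).
by apply: ereal_inf_lbound; exists n => /=.
Qed.

(** Fatou's lemma needs pointwise convergence alone. The number of cells may vary freely with [n],
    since a Riemann sum at left endpoints always dominates the integral of a nonincreasing
    function. *)
Lemma fatou_riemann (a : nat -> R -> R) (c : R -> R) (T l : R) (v : R^nat) : 0 < T ->
  (forall n, nonincreasing_fun (a n)) -> (forall n x, 0 <= a n x) ->
  (forall t, 0 <= t -> a n t @[n --> \oo] --> c t) ->
  (forall n, exists2 M, (0 < M)%N &
    (T / M%:R) * \sum_(i < M) a n (i%:R * (T / M%:R)) <= v n) ->
  v n @[n --> \oo] --> l ->
  (\int[leb]_(t in `[0%R, T[) (c t)%:E <= l%:E)%E.
Proof.
move=> T0 ani a0 ac av vl.
apply: (@le_trans _ _ (\int[leb]_(t in `[0%R, T[) limn_einf (fun n => (a n t)%:E))%E).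
  rewrite le_eqVlt; apply/orP; left; apply/eqP; apply: eq_integral => t.
  rewrite inE/= in_itv/= => /andP[t0 _]; symmetry.
  suff H : (a n t)%:E @[n --> \oo] --> (c t)%:E by have [] := cvg_limn_einf_sup H.
  by apply: cvg_EFin; [exact: nearW|exact: ac].
apply: le_trans (fatou _ _ _ _) _ => //.
- by move=> n; apply/measurable_EFinP; exact: nonincreasing_measurable.
- by move=> n x _; rewrite lee_fin.
apply: limn_einf_le vl => n; have [M M0 h] := av n.
have MT : M%:R * (T / M%:R) = T by rewrite mulrC mulfVK// gt_eqF// ltr0n.
rewrite -{1}MT; apply: le_trans (integral_le_riemann_sum _ _ _ _) _ => //.
by rewrite divr_gt0// ltr0n.
Qed.

Lemma integral_ray_le (c : R -> R) (A : R) : nonincreasing_fun c ->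
  (forall x, 0 <= c x) ->
  (forall n : nat, (\int[leb]_(t in `[0%R, n.+1%:R%R[) (c t)%:E <= A%:E)%E) ->
  (\int[leb]_(t in `[0%R, +oo[) (c t)%:E <= A%:E)%E.
Proof.
move=> cni c0 cA.
have -> : `[0, +oo[%classic = \bigcup_n `[0, n.+1%:R[%classic :> set R.
  apply/seteqP; split => x /=.
    rewrite in_itv/= andbT => x0; exists (Num.bound x) => //=.
    by rewrite in_itv/= x0 (lt_trans (archi_boundP x0))// ltr_nat.
  by move=> [n _]; rewrite /= !in_itv/= => /andP[->].
have H : (\int[leb]_(t in `[0%R, i.+1%:R%R[) (c t)%:E)%E @[i --> \oo] -->
    (\int[leb]_(t in \bigcup_n `[0%R, n.+1%:R%R[%classic) (c t)%:E)%E.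
  apply: ge0_nondecreasing_set_cvg_integral => //.
  - move=> m n mn; rewrite subsetEset => x /=; rewrite !in_itv/= => /andP[-> h].
    by rewrite (lt_le_trans h)// ler_nat.
  - by move=> i; apply/measurable_EFinP; exact: nonincreasing_measurable.
  - by move=> i x _; rewrite lee_fin.
rewrite -(cvg_lim _ H)//; apply: lime_le; first by apply/cvg_ex; eexists; exact: H.
by apply: nearW => n; exact: cA.
Qed.
End MonotoneIntegral.

(** * The Green-Kubo formula and the lower bounds *)

Section GreenKuboBound.
Variables (R : realType) (S : R -> (Omega -> R) -> Omega -> R).
Hypotheses (hS : markov_semigroup S) (hL : generated_by S (@generator R)).
Variables (p : R) (mu : probability OmegaM R).
Hypothesis hmu : bernoulli_product p mu.

(** The autocorrelation per site of a block is a Cesaro mean of the symmetric partial sums, which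
    converge by summability of the covariances. *)
Lemma current_correlation_limit t : 0 <= t -> exists2 c,
  current_correlation mu S t = c%:E &
  (n.+1%:R^-1 * autocorrelation S mu (total_current n.+1) t) @[n --> \oo] --> c.
Proof.
move=> t0; have jq := quasilocal_semigroup hS hL t0 (quasilocal_local (@local_on_current R)).
have [B hB] := covariance_summable hmu jq.
have [c cE cc] := sumZ_symmetric_sum hB.
exists c => //; rewrite (_ : (fun n => _) =
    arithmetic_mean (symmetric_sum (current_covariance S mu t))); first exact: cesaro cc.
apply/funext => n; rewrite /arithmetic_mean/= (autocorrelation_total_current hS hL hmu)//.
by rewrite /series/= big_mkord.
Qed.

Local Notation cor t := (current_correlation mu S t).

Lemma green_kubo_integral_le (lam : R) :
  (0 <= \int[lebesgue_measure]_(t in `[0%R, +oo[) cor t <=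
   (nongradient_energy p lam / 2)%:E)%E.
Proof.
(* Negative times, where [S] is unconstrained, are given the value at 0, so that [c] and [a n] are
   nonincreasing on the whole line. *)
pose c t := fine (cor (Num.max t 0)).
pose a n t : R := n.+1%:R^-1 * autocorrelation S mu (total_current n.+1) (Num.max t 0).
have Ja n := uapprox_total_current (R := R) n.
have m0 (t : R) : 0 <= Num.max t 0 by rewrite le_max lexx orbT.
have mE (t : R) : 0 <= t -> Num.max t 0 = t by move=> t0; apply/max_idPl.
have ac t : a n t @[n --> \oo] --> c t.
  by rewrite /c; have [l -> h] := current_correlation_limit (m0 t).
have corE t : 0 <= t -> cor t = (c t)%:E.
  by move=> t0; rewrite /c mE//; have [l -> _] := current_correlation_limit t0.
have ani n : nonincreasing_fun (a n).
  move=> x y xy; rewrite ler_pM2l ?invr_gt0//.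
  apply: (autocorrelation_nonincreasing hS hL hmu) => //.
  by rewrite ge_max !le_max xy lexx orbT.
have a0 n x : 0 <= a n x.
  by rewrite mulr_ge0 ?invr_ge0//; apply: (autocorrelation_ge0 hS hL hmu).
have cni : nonincreasing_fun c.
  move=> x y xy; apply: (ler_cvg_to (ac y) (ac x)); apply: nearW => n; exact: ani.
have c0 x : 0 <= c x.
  by apply: (cvgr_to_ge (ac x)); apply: nearW => n; exact: a0.
have -> : (\int[lebesgue_measure]_(t in `[0%R, +oo[) cor t =
    \int[lebesgue_measure]_(t in `[0%R, +oo[) (c t)%:E)%E.
  by apply: eq_integral => t; rewrite inE/= in_itv/= andbT => t0; exact: corE.
apply/andP; split.
  by apply: integral_ge0 => x _; rewrite lee_fin.
set A := nongradient_energy p lam / 2; apply: integral_ray_le => // N.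
pose T : R := N.+1%:R; have T0 : 0 < T by rewrite ltr0n.
apply/lee_addgt0Pr => e e0.
(* With [T] fixed, this makes the term [2 d T^2 c(0)], which survives as [n] tends to infinity, at
   most [e]. *)
pose d := e / (2 * T ^+ 2 * (c 0 + 1)).
have d0 : 0 < d by rewrite divr_gt0// !mulr_gt0// ?exprn_gt0// ltr_wpDl.
(* The boundary cost plus the slack 1 granted to the Riemann sum; divided by the block length it
   tends to 0. *)
pose K := (1 + 10 * `|lam|) ^+ 2 / (2 * d) + 1.
pose v n := A + K * n.+1%:R^-1 + 2 * d * T ^+ 2 * a n 0.
apply: (@le_trans _ _ (A + 2 * d * T ^+ 2 * c 0)%:E); last first.
  rewrite -EFinD lee_fin lerD2l.
  have -> : 2 * d * T ^+ 2 * c 0 = e * (c 0 / (c 0 + 1)).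
    rewrite /d; field; rewrite !gt_eqF//; have := c0 0; lra.
  apply: ler_piMr; first exact: ltW.
  by rewrite ler_pdivrMr ?mul1r ?lerDl// ltr_wpDl.
apply: (@fatou_riemann _ a c T _ v) => //.
- move=> n.
  have [M M0 h] := riemann_sum_bound hS hL hmu lam n.+1 d0 T0 ltr01.
  exists M => //; rewrite /v /a (mE 0)// -mulr_sumr mulrCA.
  have hE : \sum_(i < M) autocorrelation S mu (total_current n.+1)
      (Num.max (i%:R * (T / M%:R)) 0) = \sum_(i < M)
      autocorrelation S mu (total_current n.+1) (i%:R * (T / M%:R)).
    by apply: eq_bigr => i _; rewrite mE// mulr_ge0// divr_ge0// ltW.
  rewrite hE mulrC ler_pdivrMr//; apply: le_trans h _.
  rewrite le_eqVlt; apply/orP; left; apply/eqP; rewrite /A /K.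
  have : n.+1%:R != 0 :> R by rewrite pnatr_eq0.
  by move: (n.+1%:R) => x x0; field; rewrite x0 gt_eqF.
- have -> : A + 2 * d * T ^+ 2 * c 0 = A + K * 0 + 2 * d * T ^+ 2 * c 0.
    by rewrite mulr0 addr0.
  apply: cvgD; last by apply: cvgM; [exact: cvg_cst|exact: ac].
  apply: cvgD; first exact: cvg_cst.
  by apply: cvgM; [exact: cvg_cst|exact: cvg_harmonic].
Qed.

Lemma instantaneous_termE : instantaneous_term mu = p * (1 - p) * (1 - p ^+ 2).
Proof.
rewrite /instantaneous_term !big_cons big_nil addr0.
have e1 : \int[mu]_eta (rate R 0 1 eta * (occ R eta 0 - occ R eta 1) ^+ 2) =
    (1 - p ^+ 2) * (2 * p * (1 - p)).
  rewrite [RHS](_ : _ = (1 + 2 * 0 * p + (-1) * p ^+ 2) * (2 * p * (1 - p))); last by ring.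
  rewrite -(expect_bond_poly hmu 0 1 0 (-1)); apply: eq_expect => eta.
  by rewrite (rateS _ 0) /bond_rate; congr (_ * _); ring.
have e2 : \int[mu]_eta (rate R 0 (-1) eta * (occ R eta 0 - occ R eta (-1)) ^+ 2) =
    (1 - p ^+ 2) * (2 * p * (1 - p)).
  rewrite [RHS](_ : _ = (1 + 2 * 0 * p + (-1) * p ^+ 2) * (2 * p * (1 - p))); last by ring.
  rewrite -(expect_bond_poly hmu (-1) 1 0 (-1)); apply: eq_expect => eta.
  rewrite (rateSC _ (-1)) /bond_rate (_ : -1 + 1 = 0 :> int)//.
  by congr (_ * _); ring.
by rewrite e1 e2; field.
Qed.

(** The value [1 / (1 + q)] of [lam] minimizes the quadratic [nongradient_energy p]. *)
Lemma diffusion_coefficient_bound : 0 < p -> p < 1 ->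
  green_kubo p mu S \is a fin_num /\
  2 * (1 - p) / (1 + (1 - p)) <= diffusion_coefficient p mu S.
Proof.
move=> p0 p1; have /andP[] := green_kubo_integral_le (1 + (1 - p))^-1.
rewrite /diffusion_coefficient /green_kubo instantaneous_termE.
(* The two-sided bound excludes both infinite values, so [fine] returns the actual Green-Kubo
   value. *)
case: (\int[_]_(_ in _) _)%E => [I||]//; rewrite !lee_fin => I0 IA.
rewrite -EFinB -EFinM; split => //=.
have pq0 : 0 < p * (1 - p) by rewrite mulr_gt0// subr_gt0.
rewrite [leRHS]mulrC ler_pdivlMr//.
suff : nongradient_energy p (1 + (1 - p))^-1 / 2 =
    p * (1 - p) * (1 - p ^+ 2) - 2 * (1 - p) / (1 + (1 - p)) * (p * (1 - p)) by lra.
by rewrite /nongradient_energy; field; rewrite gt_eqF//; lra.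
Qed.
End GreenKuboBound.

Theorem theorem3p12 (R : realType) (p : R) (hp0 : 0 < p) (hp1 : p < 1)
    (mu : probability OmegaM R) (hmu : bernoulli_product p mu)
    (S : R -> (Omega -> R) -> Omega -> R) (hS : markov_semigroup S)
    (hL : generated_by S (@generator R)) :
  let q := 1 - p in
  let D := diffusion_coefficient p mu S in
  green_kubo p mu S \is a fin_num /\
  [/\ 2 * q / (1 + q) <= D,
      9 * q ^+ 2 / (7 - 4 * q + 6 * q ^+ 2) <= D,
      5000^-1 * p * q ^+ 9 <= D &
      D != 0].
Proof.
move=> q D; have [fin Dq] := diffusion_coefficient_bound hS hL hmu hp0 hp1.
have q0 : 0 < q by rewrite subr_gt0.
have q1 : q < 1 by rewrite /q; lra.
have B0 : 0 < 2 * q / (1 + q) by apply: divr_gt0; lra.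
split => //; split => //.
- apply: le_trans Dq; rewrite -/q.
  have h1 : 0 < 1 + q by lra.
  have h2 : 0 < 7 - 4 * q + 6 * q ^+ 2 by have := sqr_ge0 q; lra.
  rewrite ler_pdivrMr// [leRHS]mulrAC ler_pdivlMr// -subr_ge0.
  (* The cross-multiplied difference factors with a root at [q = 1], where the two bounds
     coincide. *)
  have -> : 2 * q * (7 - 4 * q + 6 * q ^+ 2) - 9 * q ^+ 2 * (1 + q) =
    q * ((1 - q) * (14 - 3 * q)) by ring.
  by apply: mulr_ge0; [lra|apply: mulr_ge0; lra].
- apply: le_trans Dq; rewrite -/q.
  have h1 : 0 < 1 + q by lra.
  rewrite ler_pdivlMr//.
  have c0 : 0 <= 5000^-1 :> R by lra.
  have c1 : 5000^-1 <= 2^-1 :> R by lra.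
  (* It is enough that [c] lies in [[0, 1/2]]: then [c (1 + q) <= 1], and [p q^9 <= q] reduces the
     claim to [q <= 2 q]. *)
  move: (5000^-1 : R) c0 c1 => c c0 c1.
  have q8 : q ^+ 8 <= 1 by rewrite exprn_ile1// ltW.
  have q80 : 0 <= q ^+ 8 by rewrite exprn_ge0// ltW.
  rewrite exprS; move: (q ^+ 8) q8 q80 => x x1 x0.
  have pq : p * (q * x) <= 1 * (q * 1).
    by apply: ler_pM; [lra|apply: mulr_ge0; lra|lra|apply: ler_pM; lra].
  have pq0 : 0 <= p * (q * x) by rewrite !mulr_ge0// ltW.
  have -> : c * p * (q * x) * (1 + q) = c * (1 + q) * (p * (q * x)) by ring.
  apply: (@le_trans _ _ (1 * (1 * (q * 1)))); last by rewrite !mul1r mulr1; lra.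
  apply: ler_pM; [by apply: mulr_ge0; lra|by []| |by []].
  by rewrite -[leRHS](mulVf (_ : 2 != 0 :> R))//; apply: ler_pM; lra.
- by rewrite gt_eqF// (lt_le_trans B0).
Qed.
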